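(* Let $\Gamma=(V,E)$ be a finite layered graph with $V=\bigcup_{i=0}^n V_i$, $V_0=\{*\}$ (so $*$ is the unique minimal element, of level $0$), such that every vertex $v\in V_+=\bigcup_{i=1}^nV_i$ is the tail of at least one edge, and let $h(t)$ denote the Hilbert series of $A(\Gamma)$. Then $$\frac{1-t}{h(t)}=1+\sum_{v_1>v_2>\dots>v_\ell\ge *}(-1)^{\ell}\,t^{|v_1|-|v_\ell|+1},$$ where the sum runs over all $\ell\ge1$ and all chains $v_1>v_2>\dots>v_\ell$ of vertices of $V$.
   Context: A directed graph $\Gamma=(V,E)$ consists of a set $V$ of vertices, a set $E$ of edges, and maps $\mathbf t,\mathbf h:E\to V$ (tail and head). It is layered if $V=\bigcup_{i=0}^n V_i$, $E=\bigcup_{i=1}^n E_i$ with $\mathbf t(E_i)\subseteq V_i$ and $\mathbf h(E_i)\subseteq V_{i-1}$; for $v\in V_i$ write $|v|=i$ (the level of $v$). A path from $v$ to $w$ is a sequence of edges $\pi=(e_1,\dots,e_m)$ with $\mathbf t(e_1)=v$, $\mathbf h(e_m)=w$, $\mathbf t(e_{i+1})=\mathbf h(e_i)$; its length is $m$. Write $v>w$ if there is a path of positive length from $v$ to $w$, and $v\ge w$ if $v>w$ or $v=w$. Fix a field $F$ and let $T(E)$ be the free associative $F$-algebra on $E$. For a path $\pi=(e_1,\dots,e_m)$ put $P_\pi(\tau)=(\tau-e_1)\cdots(\tau-e_m)\in T(E)[\tau]$ ($\tau$ a central indeterminate) and write $P_\pi(\tau)=\sum_{j=0}^m e(\pi,j)\tau^{m-j}$.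 Let $R$ be the two-sided ideal of $T(E)$ generated by all $e(\pi_1,k)-e(\pi_2,k)$ where $\pi_1,\pi_2$ are paths with the same tail and the same head and $1\le k\le$ length of $\pi_1$. Then $A(\Gamma)=T(E)/R$, graded by giving each edge degree $1$; its Hilbert series is $\sum_i\dim A(\Gamma)_i\,t^i$. *)

(* Defs.v *)
From HB Require Import structures.
From mathcomp Require Import all_boot all_order all_algebra.
From mathcomp Require Import ring_quotient boolp.
From mathcomp Require Import finmap monalg.
From Stdlib Require Import ClassicalEpsilon.

Set Implicit Arguments.
Unset Strict Implicit.
Unset Printing Implicit Defensive.

Import GRing.Theory.

Local Open Scope ring_scope.
Local Open Scope quotient_scope.

(** * Two-sided ideals and quotient algebras *)

Definition two_sided_ideal (T : pzRingType) (I : T -> Prop) : Prop :=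
  [/\ I 0, forall x y, I x -> I y -> I (x - y),
      forall a x, I x -> I (a * x) & forall a x, I x -> I (x * a)].

Definition ideal_gen (T : pzRingType) (S : T -> Prop) (x : T) : Prop :=
  forall I : T -> Prop, two_sided_ideal I -> (forall s, S s -> I s) -> I x.

Lemma ideal_genP (T : pzRingType) (S : T -> Prop) :
  two_sided_ideal (ideal_gen S).
Proof.
split=> [I []//|x y Sx Sy I Iid SI|a x Sx I Iid SI|a x Sx I Iid SI].
- by case: (Iid) => _ + _ _; apply; [apply: Sx | apply: Sy].
- by case: (Iid) => _ _ + _; apply; apply: Sx.
- by case: (Iid) => _ _ _; apply; apply: Sx.
Qed.

Definition ideal_pred (T : pzRingType) (S : T -> Prop) : {pred T} :=
  fun x => `[< ideal_gen S x >].

Section IdealPred.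
Variables (T : pzRingType) (S : T -> Prop).

Lemma ideal_predP x : reflect (ideal_gen S x) (x \in ideal_pred S).
Proof. exact: asboolP. Qed.

Fact ideal_pred_zmod_closed : zmod_closed (ideal_pred S).
Proof.
case: (ideal_genP S) => S0 SB _ _.
by split=> [|x y /ideal_predP Sx /ideal_predP Sy]; apply/ideal_predP => //;
  apply: SB.
Qed.
HB.instance Definition _ :=
  GRing.isZmodClosed.Build T (ideal_pred S) ideal_pred_zmod_closed.

Lemma ideal_predMl a x : x \in ideal_pred S -> a * x \in ideal_pred S.
Proof.
by case: (ideal_genP S) => _ _ SM _ /ideal_predP Sx; apply/ideal_predP; exact: SM.
Qed.

Lemma ideal_predMr a x : x \in ideal_pred S -> x * a \in ideal_pred S.
Proof.
by case: (ideal_genP S) => _ _ _ SM /ideal_predP Sx; apply/ideal_predP; exact: SM.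
Qed.

End IdealPred.

Definition quot_alg (T : pzRingType) (S : T -> Prop) : Type :=
  @Quotient.quot T (ideal_pred S).

Section QuotRing.
Variables (T : pzRingType) (S : T -> Prop).

HB.instance Definition _ := GRing.Zmodule.on (quot_alg S).

Definition to_quot (x : T) : quot_alg S :=
  \pi_(@Quotient.quot T (ideal_pred S)) x.

Definition of_quot (x : quot_alg S) : T :=
  repr (x : @Quotient.quot T (ideal_pred S)).

Lemma of_quotK : cancel of_quot to_quot.
Proof. exact: reprK. Qed.

Lemma to_quot_eq x y : to_quot x = to_quot y <-> ideal_gen S (x - y).
Proof.
have h := Quotient.idealrBE (ideal_pred S) x y.
split=> [e|e]; first by apply/ideal_predP; rewrite h; apply/eqP.
by apply/eqP; rewrite /to_quot -h; apply/ideal_predP.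
Qed.

Lemma to_quotD : {morph to_quot : x y / x + y}.
Proof. by move=> x y; rewrite /to_quot -raddfD. Qed.

Definition quot_one : quot_alg S := to_quot 1.
Definition quot_mul (x y : quot_alg S) := to_quot (of_quot x * of_quot y).

Lemma to_quotM x y : to_quot (x * y) = quot_mul (to_quot x) (to_quot y).
Proof.
apply/to_quot_eq/ideal_predP; set x' := of_quot _; set y' := of_quot _.
have hx : x - x' \in ideal_pred S.
  by apply/ideal_predP/to_quot_eq; rewrite of_quotK.
have hy : y - y' \in ideal_pred S.
  by apply/ideal_predP/to_quot_eq; rewrite of_quotK.
have -> : x * y - x' * y' = (x - x') * y + x' * (y - y').
  by rewrite mulrBl mulrBr addrA subrK.
by apply: rpredD; [apply: ideal_predMr | apply: ideal_predMl].
Qed.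

Fact quot_mulA : associative quot_mul.
Proof.
move=> x y z; rewrite -[x]of_quotK -[y]of_quotK -[z]of_quotK.
by rewrite -!to_quotM mulrA.
Qed.
Fact quot_mul1 : left_id quot_one quot_mul.
Proof. by move=> x; rewrite -[x]of_quotK -to_quotM mul1r. Qed.
Fact quot_1mul : right_id quot_one quot_mul.
Proof. by move=> x; rewrite -[x]of_quotK -to_quotM mulr1. Qed.
Fact quot_mulDl : left_distributive quot_mul +%R.
Proof.
move=> x y z; rewrite -[x]of_quotK -[y]of_quotK -[z]of_quotK.
by rewrite -to_quotD -!to_quotM -to_quotD mulrDl.
Qed.
Fact quot_mulDr : right_distributive quot_mul +%R.
Proof.
move=> x y z; rewrite -[x]of_quotK -[y]of_quotK -[z]of_quotK.
by rewrite -to_quotD -!to_quotM -to_quotD mulrDr.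
Qed.
HB.instance Definition _ := GRing.Zmodule_isPzRing.Build (quot_alg S)
  quot_mulA quot_mul1 quot_1mul quot_mulDl quot_mulDr.

End QuotRing.

Section QuotAlg.
Variables (F : fieldType) (T : lalgType F) (S : T -> Prop).

Definition quot_scale (c : F) (x : quot_alg S) : quot_alg S :=
  to_quot S (c *: of_quot x).

Lemma to_quotZ c x : to_quot S (c *: x) = quot_scale c (to_quot S x).
Proof.
apply/to_quot_eq/ideal_predP; rewrite -scalerBr -mulr_algl.
by apply/ideal_predMl/ideal_predP/to_quot_eq; rewrite of_quotK.
Qed.

Fact quot_scaleA a b x : quot_scale a (quot_scale b x) = quot_scale (a * b) x.
Proof. by rewrite -[x]of_quotK -!to_quotZ scalerA. Qed.
Fact quot_scale1 : left_id 1 quot_scale.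
Proof. by move=> x; rewrite -[x]of_quotK -to_quotZ scale1r. Qed.
Fact quot_scaleDr : right_distributive quot_scale +%R.
Proof.
move=> c x y; rewrite -[x]of_quotK -[y]of_quotK.
by rewrite -to_quotD -!to_quotZ -to_quotD scalerDr.
Qed.
Fact quot_scaleDl x : {morph quot_scale^~ x : a b / a + b}.
Proof.
by move=> a b; rewrite -[x]of_quotK -!to_quotZ -to_quotD scalerDl.
Qed.
HB.instance Definition _ := GRing.Zmodule_isLmodule.Build F (quot_alg S)
  quot_scaleA quot_scale1 quot_scaleDr quot_scaleDl.

(* Not packaged as an [lalgType]: the quotient may be trivial. *)
Lemma quot_scaleAl c (x y : quot_alg S) : c *: (x * y) = (c *: x) * y.
Proof.
transitivity (to_quot S (c *: (of_quot x * of_quot y))).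
  by rewrite to_quotZ to_quotM !of_quotK.
by rewrite scalerAl to_quotM to_quotZ !of_quotK.
Qed.

End QuotAlg.

(** * Dimension *)

Definition is_basis (F : fieldType) (V : lmodType F) (U : V -> Prop)
    (d : nat) (b : 'I_d -> V) : Prop :=
  [/\ forall i, U (b i),
      forall c : 'I_d -> F, \sum_i c i *: b i = 0 -> forall i, c i = 0
    & forall x, U x -> exists c : 'I_d -> F, x = \sum_i c i *: b i].

(* Only meaningful on subspaces having a finite basis; unspecified elsewhere. *)
Definition dimension (F : fieldType) (V : lmodType F) (U : V -> Prop) : nat :=
  epsilon (inhabits 0%N)
    (fun d => exists b : 'I_d -> V, @is_basis F V U d b).

(** * Directed graphs *)

Record digraph := Digraph {
  vertex : finType;
  edge : finType;
  tail_of : edge -> vertex;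
  head_of : edge -> vertex }.

(* V_i is the fibre of [lev] over i, and E_i consists of the edges whose tail
   has level i. *)
Definition layering (G : digraph) (n : nat) (lev : vertex G -> nat) : Prop :=
  (forall v, lev v <= n)%N /\
  (forall e : edge G, lev (tail_of e) = (lev (head_of e)).+1).

Definition is_path (G : digraph) (v w : vertex G) (p : seq (edge G)) : bool :=
  if p is e :: q then
    [&& tail_of e == v, path (fun e1 e2 => tail_of e2 == head_of e1) e q
      & head_of (last e q) == w]
  else false.

Definition gtv (G : digraph) (v w : vertex G) : bool :=
  `[< exists p, is_path v w p >].

Definition gev (G : digraph) (v w : vertex G) : bool := gtv v w || (v == w).

(** * The algebra of a directed graph *)

Section GraphAlgebra.
Variables (F : fieldType) (G : digraph).

Definition free_alg : lalgType F := {malg F[{fmonom (edge G)}]}.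

Definition edge_gen (e : edge G) : free_alg := << fmu e >>.

(* The noncommutative product is taken in the order of the path; the variable
   of [{poly free_alg}] is central. *)
Definition path_poly (p : seq (edge G)) : {poly free_alg} :=
  \prod_(e <- p) ('X - (edge_gen e)%:P).

(* For j <= size p; in a layered graph, paths with the same endpoints have the
   same length, so [relator] only uses this range. *)
Definition path_coef (p : seq (edge G)) (j : nat) : free_alg :=
  (path_poly p)`_(size p - j).

Definition relator (x : free_alg) : Prop :=
  exists (v w : vertex G) (p1 p2 : seq (edge G)) (k : nat),
    [/\ is_path v w p1, is_path v w p2, (1 <= k <= size p1)%N
      & x = path_coef p1 k - path_coef p2 k].

Definition graph_alg := quot_alg relator.

(* x lies in the degree i component of the free algebra. *)
Definition homogeneous (i : nat) (x : free_alg) : Prop :=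
  forall m, m \in msupp x -> fdeg m = i.

Definition graded_piece (i : nat) (a : graph_alg) : Prop :=
  exists2 x, homogeneous i x & a = to_quot relator x.

End GraphAlgebra.

(** * Formal power series, as coefficient sequences *)

Section PowerSeries.
Variable K : fieldType.

Definition fps := nat -> K.

Definition fps_poly (p : {poly K}) : fps := fun n => p`_n.

Definition fps_mul (f g : fps) : fps :=
  fun n => \sum_(i < n.+1) f i * g (n - i)%N.

(* The coefficients of degree 0, ..., n of the inverse of f. *)
Fixpoint fps_inv_upto (f : fps) (n : nat) : seq K :=
  if n is m.+1 then
    let s := fps_inv_upto f m in
    rcons s (- (f 0%N)^-1 * \sum_(i < n) f (n - i)%N * s`_i)
  else [:: (f 0%N)^-1].

Definition fps_inv (f : fps) : fps := fun n => (fps_inv_upto f n)`_n.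

(* Meaningful when the constant coefficient of g is nonzero, cf. [fps_mulV]. *)
Definition fps_div (f g : fps) : fps := fps_mul f (fps_inv g).

Lemma size_fps_inv_upto f n : size (fps_inv_upto f n) = n.+1.
Proof. by elim: n => //= n IHn; rewrite size_rcons IHn. Qed.

Lemma nth_fps_inv_upto f n i : (i <= n)%N ->
  (fps_inv_upto f n)`_i = fps_inv f i.
Proof.
elim: n => [|n IHn]; first by case: i.
rewrite leq_eqVlt => /orP[/eqP -> //|lt_in].
by rewrite /= nth_rcons size_fps_inv_upto lt_in IHn.
Qed.

Lemma fps_mulV f : f 0%N != 0 -> fps_mul f (fps_inv f) =1 fps_poly 1.
Proof.
move=> f0 [|n]; rewrite /fps_mul /fps_poly coef1 /=.
  by rewrite big_ord1 /= /fps_inv /= divff.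
rewrite big_ord_recl subn0 {1}/fps_inv /= nth_rcons size_fps_inv_upto ltnn eqxx.
rewrite mulrA mulrN divff // mulN1r addrC; apply/eqP; rewrite subr_eq0; apply/eqP.
rewrite (reindex_inj rev_ord_inj) /=; apply: eq_bigr => i _.
rewrite nth_fps_inv_upto; last by rewrite -ltnS.
by congr (f _ * fps_inv _ _); rewrite /bump /= ?subSS; have := ltn_ord i;
  rewrite ltnS => le_in; rewrite ?add1n ?subSS ?subKn // subSn.
Qed.

End PowerSeries.

Definition hilbert_series (F : fieldType) (G : digraph) : fps rat :=
  fun i => (dimension (@graded_piece F G i))%:R.

(** * Chains of vertices *)

Definition is_chain (G : digraph) (star : vertex G) (c : seq (vertex G)) : bool :=
  [&& (0 < size c)%N, sorted (@gtv G) c & gev (last star c) star].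

(* [star] is a default value for [head] and [last]; it is irrelevant on chains,
   which are nonempty. *)
Definition chain_exp (G : digraph) (lev : vertex G -> nat) (star : vertex G)
    (c : seq (vertex G)) : nat :=
  (lev (head star c) - lev (last star c) + 1)%N.

Lemma is_path_lev (G : digraph) n (lev : vertex G -> nat) (v w : vertex G) p :
  layering n lev -> is_path v w p -> lev v = (size p + lev w)%N.
Proof.
move=> [_ hE]; case: p => // e q /= /and3P[/eqP <- + /eqP <-].
elim: q e => [|e' q IHq] e /=; first by rewrite hE.
by case/andP=> /eqP he /IHq {}IHq; rewrite hE -he IHq.
Qed.

Lemma gtv_lev (G : digraph) n (lev : vertex G -> nat) (v w : vertex G) :
  layering n lev -> gtv v w -> (lev w < lev v)%N.
Proof.
move=> hG /asboolP[p hp]; rewrite (is_path_lev hG hp).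
by case: p hp => //= e p _; rewrite addSn ltnS leq_addl.
Qed.

Lemma sorted_gtv_uniq (G : digraph) n (lev : vertex G -> nat) (c : seq (vertex G)) :
  layering n lev -> sorted (@gtv G) c -> uniq c.
Proof.
move=> hG hc; apply: (@map_uniq _ _ lev).
apply: (@sorted_uniq _ (fun i j => j < i)%N).
- by move=> i j k ij ki; apply: ltn_trans ki ij.
- by move=> i; rewrite ltnn.
by rewrite sorted_map; apply: sub_sorted hc => v w; apply: gtv_lev hG.
Qed.

(* So a sum over all chains may be taken over lengths 1 <= l <= #|V|. *)
Lemma size_chain (G : digraph) n (lev : vertex G -> nat) star (c : seq (vertex G)) :
  layering n lev -> is_chain star c -> (size c <= #|vertex G|)%N.
Proof.
move=> hG /and3P[_ hc _].
by rewrite -(card_uniqP (sorted_gtv_uniq hG hc)) max_card.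
Qed.

(* Main.v *)
Require Import Defs.
From HB Require Import structures.
From mathcomp Require Import all_boot all_order all_algebra.
From mathcomp Require Import boolp finmap monalg zify ring.
From Stdlib Require Import ClassicalEpsilon.

(* Let P_v be the common value of P_pi over the paths pi from v to *, and e(v, k)
   its coefficients.  A(Gamma) is the universal algebra generated by the
   coefficients of monic polynomials P_v of degree |v| such that
   P_v = (tau - e) P_w for every edge e from v to w.  Equivalently, a left module
   over it is a vector space with operators e(v, k) such that, for v > w, every
   sequence satisfying the linear recurrence with characteristic polynomial P_w
   also satisfies the one of P_v.

   Such operators exist on the span M of all words in the letters (v, k): e(v, k)
   prepends its letter to a word x, unless x = (u, m) y with v > u and
   |v| - |u| = k.  In that case take the solution z of the recurrence of u whose
   only nonzero initial term is z_(|u| - m) = y.  Then z_|u| = - x, and the value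
   of e(v, k) x is dictated by the recurrence of v for z.  The words in which no two
   consecutive letters are of this form (the normal words) applied to the empty
   word return themselves, so their images in A(Gamma) are independent.  They span
   because the evaluation map from M to A(Gamma) commutes with all e(v, k).
   So the Hilbert series counts normal words by degree, and splitting them by
   their first vertex gives a linear system that the sum over chains solves. *)

Set Implicit Arguments.
Unset Strict Implicit.
Unset Printing Implicit Defensive.

Import GRing.Theory.

Local Open Scope ring_scope.

(** * Linear extension and linear recurrences *)

Section LinearExtension.
Variables (F : fieldType) (K : choiceType) (V : lmodType F).
Implicit Type g : {malg F[K]}.

Fact lin_ext_key : unit. Proof. exact: tt. Qed.
Definition lin_ext : (K -> V) -> {malg F[K]} -> V :=
  locked_with lin_ext_key (fun f g => \sum_(k <- msupp g) g@_k *: f k).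

Lemma lin_extE f g : lin_ext f g = \sum_(k <- msupp g) g@_k *: f k.
Proof. by rewrite /lin_ext locked_withE. Qed.

Lemma lin_extEw f (d : {fset K}) g : (msupp g `<=` d)%fset ->
  lin_ext f g = \sum_(k <- d) g@_k *: f k.
Proof.
move=> le_gd; rewrite lin_extE (big_fset_incl _ le_gd) // => k _ /mcoeff_outdom ->.
by rewrite scale0r.
Qed.

Lemma lin_ext_is_linear f : linear (lin_ext f).
Proof.
move=> c g h; pose d := (msupp g `|` msupp h `|` msupp (c *: g + h))%fset.
rewrite !(@lin_extEw f d);
  try by apply/fsubsetP => k; rewrite !inE => ->; rewrite ?orbT.
rewrite scaler_sumr -big_split /=; apply: eq_bigr => k _.
by rewrite mcoeffD mcoeffZ scalerDl scalerA.
Qed.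

HB.instance Definition _ f :=
  GRing.isLinear.Build F {malg F[K]} V *:%R (lin_ext f) (lin_ext_is_linear f).

Lemma lin_extU f k : lin_ext f << k >> = f k.
Proof. by rewrite lin_extE msuppU oner_eq0 big_seq_fset1 mcoeffUU scale1r. Qed.

Lemma malg_sum g : g = \sum_(k <- msupp g) g@_k *: << k >>.
Proof.
rewrite [LHS]monalgE; apply: eq_bigr => k _; apply/malgP => k'.
by rewrite mcoeffZ !mcoeffU mulrnAr mulr1.
Qed.

Lemma linear_malg_eq (f h : {linear {malg F[K]} -> V}) :
  (forall k, f << k >> = h << k >>) -> f =1 h.
Proof.
move=> fh g; rewrite [g]malg_sum !linear_sum; apply: eq_bigr => k _.
by rewrite !linearZ fh.
Qed.

End LinearExtension.

(** * Elements of a free module supported on a given set of basis vectors *)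

Section SpannedBy.
Variables (F : fieldType) (K : choiceType).
Implicit Type g : {malg F[K]}.

Definition spanned_by (P : pred K) g := forall k, k \in msupp g -> P k.

Variable P : pred K.

Lemma spanned0 : spanned_by P 0.
Proof. by move=> k; rewrite msupp0. Qed.

Lemma spannedU k : P k -> spanned_by P << k >>.
Proof. by move=> Pk k'; rewrite msuppU oner_eq0 inE => /eqP ->. Qed.

Lemma spannedN g : spanned_by P g -> spanned_by P (- g).
Proof. by move=> Pg k; rewrite msuppN; apply: Pg. Qed.

Lemma spannedD g h : spanned_by P g -> spanned_by P h -> spanned_by P (g + h).
Proof.
move=> Pg Ph k /(fsubsetP (msuppD_le g h)).
by rewrite inE => /orP[/Pg|/Ph].
Qed.

Lemma spannedZ c g : spanned_by P g -> spanned_by P (c *: g).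
Proof. by move=> Pg k /(fsubsetP (msuppZ_le c g))/Pg. Qed.

Lemma spanned_sum (I : eqType) (r : seq I) (Q : pred I) (f : I -> {malg F[K]}) :
  (forall i, i \in r -> Q i -> spanned_by P (f i)) ->
  spanned_by P (\sum_(i <- r | Q i) f i).
Proof.
move=> Pf; rewrite big_seq_cond.
elim/big_ind: _ => [|g h|i /andP[]]; [exact: spanned0|exact: spannedD|exact: Pf].
Qed.

End SpannedBy.

Lemma spanned_linear (F : fieldType) (K K' : choiceType) (P : pred K)
    (Q : pred K') (f : {linear {malg F[K]} -> {malg F[K']}}) g :
  (forall k, P k -> spanned_by Q (f << k >>)) ->
  spanned_by P g -> spanned_by Q (f g).
Proof.
move=> fP Pg; rewrite [g]malg_sum linear_sum; apply: spanned_sum => k kg _.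
by rewrite linearZ; apply/spannedZ/fP/Pg.
Qed.

Lemma sum_rev (V : zmodType) (f : nat -> nat -> V) l :
  \sum_(k < l.+1) f k (l - k)%N = \sum_(0 <= i < l.+1) f (l - i)%N i.
Proof.
rewrite big_mkord (reindex_inj rev_ord_inj); apply: eq_bigr => i _ /=.
by rewrite subSS subKn // -ltnS.
Qed.

(** The recurrence of a vertex of level [b] on a solution for a vertex of lower level [a]: before
    index [a] only the pulse [y] contributes. The term in [x] is the one to be solved for. *)
Lemma pulse_sum (V W : zmodType) (E : nat -> V -> W) (z : nat -> V)
    x y a b m :
  (forall k, E k 0 = 0) -> (forall k, {morph E k : u / - u}) ->
  (a < b)%N -> (0 < m <= a)%N ->
  (forall i, (i < a)%N -> z i = if (i == a - m)%N then y else 0) -> z a = - x ->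
  \sum_(k < b.+1) E k (z (b - k)%N) = E (b - a + m)%N y - E (b - a)%N x
    + \sum_(a.+1 <= i < b) E (b - i)%N (z i) + E 0%N (z b).
Proof.
move=> E0 EN lt_ab hm z_init za; rewrite (sum_rev (fun k i => E k (z i))).
rewrite (@big_cat_nat _ _ _ a) //=; last by lia.
rewrite (@big_cat_nat _ _ _ a.+1 a) //=; last by lia.
rewrite big_nat1 big_nat_recr //= subnn za EN -!addrA; congr (_ + _).
have hm1 : (a - m < a)%N by lia.
rewrite big_mkord (bigD1 (Ordinal hm1)) //= z_init // eqxx.
rewrite big1 ?addr0 => [|[i hi] /eqP ne_i]; first by congr (E _ _); lia.
rewrite z_init //=; case: eqP => [e|_]; last exact: E0.
by case: ne_i; apply: val_inj.
Qed.

(** * Linear recurrences whose coefficients are operators *)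

Section Recurrence.
Variables (N : zmodType) (d : nat) (e : nat -> N -> N).

Definition rec_next (l : seq N) : N := - \sum_(k < d) e k.+1 l`_k.

(* The list holds the terms computed so far, the newest one first. *)
Definition rec_seq (l : seq N) (i : nat) : N :=
  (iter i (fun l => rec_next l :: l) l)`_d.-1.

Lemma nth_iter_rec l i j k :
  (iter (i + j) (fun l => rec_next l :: l) l)`_(i + k) =
  (iter j (fun l => rec_next l :: l) l)`_k.
Proof. by elim: i => //= i IHi. Qed.

Lemma rec_seq_init l i : (i < d)%N -> rec_seq l i = l`_(d.-1 - i).
Proof.
move=> lt_id; rewrite /rec_seq -{1}[i]addn0.
have -> : d.-1 = (i + (d.-1 - i))%N by lia.
by rewrite nth_iter_rec addKn.
Qed.

Lemma rec_seq_rec l i : (0 < d)%N ->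
  rec_seq l (i + d) = - \sum_(k < d) e k.+1 (rec_seq l (i + d - k.+1)).
Proof.
move=> d0; rewrite /rec_seq.
have -> : (i + d)%N = (d.-1 + i.+1)%N by lia.
rewrite -{2}[d.-1]addn0 nth_iter_rec /=; congr (- _).
apply: eq_bigr => k _; congr (e _ _); have ltkd := ltn_ord k.
rewrite -(nth_iter_rec l (d.-1 - k)%N i k).
by congr (nth _ (iter _ _ _) _); lia.
Qed.

Definition solves_at (i : nat) (z : nat -> N) : Prop :=
  \sum_(k < d.+1) e k (z (i + d - k)%N) = 0.

Definition solves (z : nat -> N) : Prop := forall i, solves_at i z.

(** As the newest term comes first, the entry of index [m.-1] is the initial term of index
    [d - m]. *)
Definition pulse (m : nat) (y : N) : seq N :=
  mkseq (fun k => if k == m.-1 then y else 0) d.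

Hypothesis e0 : forall x, e 0%N x = x.

Lemma solvesE z : solves z <->
  forall i, z (i + d)%N = - \sum_(k < d) e k.+1 (z (i + d - k.+1)%N).
Proof.
split=> h i; have := h i; rewrite /solves_at ?big_ord_recl /= e0 subn0.
  by move/eqP; rewrite addr_eq0 => /eqP.
by move=> ->; rewrite addNr.
Qed.

Lemma rec_seq_solves l : (0 < d)%N -> solves (rec_seq l).
Proof. by move=> d0; apply/solvesE => i; apply: rec_seq_rec. Qed.

Lemma rec_seq_pulse m y i : (0 < m <= d)%N -> (i < d)%N ->
  rec_seq (pulse m y) i = if (i == d - m)%N then y else 0.
Proof.
move=> hm lt_id; rewrite rec_seq_init // nth_mkseq; last by lia.
by congr (if _ then _ else _); apply/eqP/eqP; lia.
Qed.

Lemma solves_eq z z' : solves z -> solves z' ->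
  (forall i, (i < d)%N -> z i = z' i) -> z =1 z'.
Proof.
move=> /solvesE hz /solvesE hz' zz'; elim/ltn_ind => i IHi.
have [/zz' //|le_di] := ltnP i d.
rewrite -(subnK le_di) hz hz'; congr (- _); apply: eq_bigr => k _.
by congr (e _ _); apply: IHi; have := ltn_ord k; lia.
Qed.

Lemma solves_at_shift z i j : solves_at j (fun k => z (i + k)%N) = solves_at (i + j) z.
Proof.
rewrite /solves_at; congr (_ = _); apply: eq_bigr => k _.
by congr (e _ (z _)); have := ltn_ord k; lia.
Qed.

Lemma solves_shift z i : solves z -> solves (fun j => z (i + j)%N).
Proof. by move=> hz j; rewrite solves_at_shift; apply: hz. Qed.

End Recurrence.

Section SolvesLinear.
Variables (F : fieldType) (N : lmodType F) (d : nat) (e : nat -> {linear N -> N}).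

Lemma solves_at0 i : solves_at d e i (fun=> 0).
Proof. by rewrite /solves_at big1 // => k _; rewrite linear0. Qed.

Lemma solves_atD i z z' : solves_at d e i z -> solves_at d e i z' ->
  solves_at d e i (fun j => z j + z' j).
Proof.
rewrite /solves_at => hz hz'; under eq_bigr do rewrite linearD.
by rewrite big_split /= hz hz' addr0.
Qed.

Lemma solves_atZ i c z : solves_at d e i z -> solves_at d e i (fun j => c *: z j).
Proof.
rewrite /solves_at => hz; under eq_bigr do rewrite linearZ.
by rewrite -scaler_sumr hz scaler0.
Qed.

Lemma solves_atN i z : solves_at d e i z -> solves_at d e i (fun j => - z j).
Proof.
rewrite /solves_at => hz; under eq_bigr do rewrite linearN.
by rewrite sumrN hz oppr0.
Qed.

Lemma solves_at_sum (I : eqType) (r : seq I) (z : I -> nat -> N) i :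
  (forall j, j \in r -> solves_at d e i (z j)) ->
  solves_at d e i (fun k => \sum_(j <- r) z j k).
Proof.
elim: r => [_|j r IHr hz].
  by rewrite /solves_at big1 // => k _; rewrite big_nil linear0.
have -> : (fun k => \sum_(j <- j :: r) z j k) =
          (fun k => z j k + \sum_(j <- r) z j k).
  by apply: funext => k; rewrite big_cons.
apply: solves_atD; first by apply: hz; rewrite mem_head.
by apply: IHr => k kr; apply: hz; rewrite in_cons kr orbT.
Qed.

End SolvesLinear.

(** * Operators on words *)

Lemma is_path_cat (G : digraph) (u v w : vertex G) p q :
  is_path u v p -> is_path v w q -> is_path u w (p ++ q).
Proof.
case: p => // e p; case: q => // e' q /= /and3P[-> pP /eqP lp].
case/and3P=> /eqP tv qP lq.
by rewrite cat_path last_cat pP /= tv lp eqxx qP lq.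
Qed.

Lemma gtv_trans (G : digraph) : transitive (@gtv G).
Proof.
move=> v u w /asboolP[p pP] /asboolP[q qP].
by apply/asboolP; exists (p ++ q); apply: is_path_cat pP qP.
Qed.

Lemma gtv_edge (G : digraph) (e : edge G) : gtv (tail_of e) (head_of e).
Proof. by apply/asboolP; exists [:: e]; rewrite /= !eqxx. Qed.

Section Words.
Variables (G : digraph) (lev : vertex G -> nat).

(* The letter (v, k) stands for the coefficient e(v, k) of P_v. *)
Definition word : Type := seq (vertex G * nat).
HB.instance Definition _ := Choice.on word.

(* Not the bare condition on the first two letters: a head that itself covers the
   next letter is not covered.  The relations of A(Gamma) then hold on all words,
   with no restriction to the normal ones, where the two notions agree. *)
Fixpoint covers (v : vertex G) (k : nat) (x : word) : bool :=
  if x is (u, m) :: y then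
    [&& gtv v u, k + lev u == lev v, 0 < m <= lev u & ~~ covers u m y]%N
  else false.

Definition head_lev (x : word) : nat := if x is (u, _) :: _ then lev u else 0%N.

Fixpoint normal (x : word) : bool :=
  if x is (v, k) :: y then [&& (0 < k <= lev v)%N, ~~ covers v k y & normal y]
  else true.

Definition wdeg (x : word) : nat := sumn (map snd x).

Lemma covers_head_lev v k x : (head_lev x < lev v - k)%N -> ~~ covers v k x.
Proof.
by case: x => [|[u m] y] //= lt_u; apply/negP => /and4P[_ /eqP]; lia.
Qed.

Variable F : fieldType.
Local Notation M := {malg F[word]}.

Definition prepend (v : vertex G) (k : nat) : {linear M -> M} :=
  lin_ext (fun x : word => << ((v, k) : vertex G * nat) :: x >> : M).

(* The recursion is on the level of v, bounded by the fuel f, then on the word;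
   the value is meaningful for lev v < f. *)
Fixpoint opw (f : nat) : vertex G -> nat -> word -> M :=
  if f is f'.+1 then fun v =>
    fix opv (k : nat) (x : word) {struct x} : M :=
      if k == 0%N then << x >> else if (lev v < k)%N then 0 else
      if x is (u, m) :: y then
        if covers v k x then
          let z := rec_seq (lev u) (fun j => lin_ext (opw f' u j))
                     (pulse (lev u) m (<< y >> : M)) in
          z (lev v) + opv (k + m)%N y +
            \sum_((lev u).+1 <= i < lev v) prepend v (lev v - i) (z i)
        else << (v, k) :: x >>
      else << [:: (v, k)] >>
  else fun _ _ _ => 0.

(* Locked, as conversion would otherwise unfold the nested recursion of [opw]. *)
Fact op_key : unit. Proof. exact: tt. Qed.
Definition op : vertex G -> nat -> {linear M -> M} :=
  locked_with op_key (fun v k => lin_ext (opw (lev v).+1 v k) : {linear M -> M}).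

(** The sequence [z] inside [opw], freed of the fuel and with any vector [y] as pulse. *)
Definition sol (u : vertex G) (m : nat) (y : M) : nat -> M :=
  rec_seq (lev u) (fun j => op u j) (pulse (lev u) m y).

Lemma prependE v k x : prepend v k << x >> = << (v, k) :: x >>.
Proof. exact: lin_extU. Qed.

Lemma opwS f v k u m y : opw f.+1 v k ((u, m) :: y) =
  if k == 0%N then << (u, m) :: y >> else if (lev v < k)%N then 0 else
  if covers v k ((u, m) :: y) then
    let z := rec_seq (lev u) (fun j => lin_ext (opw f u j))
               (pulse (lev u) m (<< y >> : M)) in
    z (lev v) + opw f.+1 v (k + m)%N y +
      \sum_((lev u).+1 <= i < lev v) prepend v (lev v - i) (z i)
  else << (v, k) :: (u, m) :: y >>.
Proof. by []. Qed.

Lemma opU v k x : op v k << x >> = opw (lev v).+1 v k x.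
Proof. by rewrite /op locked_withE; apply: lin_extU. Qed.

Lemma op0 v x : op v 0%N x = x.
Proof.
by apply: (linear_malg_eq (h := idfun)) => {}x; rewrite opU; case: x.
Qed.

Lemma op_gt v k x : (lev v < k)%N -> op v k x = 0.
Proof.
move=> lt_vk; apply: (linear_malg_eq (h := \0)) => {}x; rewrite opU /=.
by case: x => [|[u m] y] /=; rewrite lt_vk; case: k lt_vk.
Qed.

Lemma op_ncovers v k x : (0 < k <= lev v)%N -> ~~ covers v k x ->
  op v k << x >> = << (v, k) :: x >>.
Proof.
case/andP=> k0 le_kv ncov; rewrite opU.
case: x ncov => [|[u m] y] ncov /=; rewrite (gtn_eqF k0) ltnNge le_kv //=.
by move: ncov => /= /negbTE ->.
Qed.

Variables (n : nat) (hG : layering n lev).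

(** A covered letter has strictly smaller level, so the inner operators need less fuel. *)
Lemma opw_fuel f f' v : (lev v < f)%N -> (lev v < f')%N -> opw f v = opw f' v.
Proof.
elim: f f' v => [//|f IHf] [//|f'] v hf hf'.
apply: funext => k; apply: funext => x.
elim: x k => [//|[u m] y IHy] k; rewrite (opwS f) (opwS f').
case: (k == 0%N); first reflexivity.
case: (lev v < k)%N; first reflexivity.
case cov: (covers v k ((u, m) :: y)); last reflexivity.
have e : opw f u = opw f' u.
by apply: IHf; case/and4P: cov => /(gtv_lev hG); lia.
rewrite (IHy (k + m)%N).
rewrite e.
reflexivity.
Qed.

Lemma covers_lev v k u m y : covers v k ((u, m) :: y) ->
  [/\ gtv v u, (0 < k)%N, (k + lev u = lev v)%N, (0 < m <= lev u)%N
    & ~~ covers u m y].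
Proof. by case/and4P=> vu /eqP kv hm ncov; split=> //; have := gtv_lev hG vu; lia. Qed.

Lemma op_covers v k u m y : covers v k ((u, m) :: y) ->
  op v k << (u, m) :: y >> = sol u m << y >> (lev v) + op v (k + m) << y >> +
    \sum_((lev u).+1 <= i < lev v) prepend v (lev v - i) (sol u m << y >> i).
Proof.
move=> cov; have [vu k0 kv hm ncov] := covers_lev cov.
rewrite !opU opwS cov (gtn_eqF k0) ltnNge.
have -> /= : (k <= lev v)%N by lia.
by rewrite /sol /op locked_withE (@opw_fuel (lev v) (lev u).+1) ?(gtv_lev hG vu).
Qed.

Lemma sol_solves u m y : (0 < lev u)%N -> solves (lev u) (fun k => op u k) (sol u m y).
Proof. by move=> u0; apply: rec_seq_solves => // x; apply: op0. Qed.

Lemma sol_init u m y i : (0 < m <= lev u)%N -> (i < lev u)%N ->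
  sol u m y i = if (i == lev u - m)%N then y else 0.
Proof. exact: rec_seq_pulse. Qed.

Lemma sol_rec u m y i : (0 < lev u <= i)%N ->
  sol u m y i = - \sum_(k < lev u) op u k.+1 (sol u m y (i - k.+1)%N).
Proof. by case/andP=> u0 le_ui; rewrite -(subnK le_ui); apply: rec_seq_rec. Qed.

End Words.

(** * Solutions for a lower vertex also solve the recurrence of a higher one *)

Section OperatorModule.
Variables (F : fieldType) (G : digraph) (lev : vertex G -> nat) (n : nat).
Hypothesis hG : layering n lev.
Local Notation M := {malg F[word G]}.
Local Notation op := (@op G lev F).
Local Notation sol := (@sol G lev F).
Local Notation solves u := (solves (lev u) (fun k => op u k)).

(** At index [lev u] the recurrence looks back at exactly the initial terms, and the pulse, at
    distance [m], is the only nonzero one. *)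
Lemma sol_at_lev u m y : (0 < m <= lev u)%N -> sol u m y (lev u) = - op u m y.
Proof.
move=> hm; have hm1 : (m.-1 < lev u)%N by lia.
rewrite sol_rec; last by lia.
rewrite (bigD1 (Ordinal hm1)) //= prednK; last by lia.
rewrite sol_init; [rewrite eqxx | lia | lia].
rewrite big1 ?addr0 // => -[k hk] /eqP ne_km.
rewrite sol_init //=; last by lia.
case: eqP => [e|]; last by rewrite linear0.
by case: ne_km; apply: val_inj => /=; lia.
Qed.

Lemma sol_spanned (P : pred (word G)) u m y i : (0 < lev u <= i)%N ->
  (forall k x, (0 < k)%N -> spanned_by P (op u k << x >>)) ->
  spanned_by P (sol u m y i).
Proof.
move=> hi hP; rewrite sol_rec //; apply/spannedN/spanned_sum => k _ _.
apply: (@spanned_linear _ _ _ predT) => // x _; exact: hP.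
Qed.

(** Every word produced starts at [v], or comes from [sol u] with [u] below [v], or from [op v] on a
    shorter word. The bound ensures that the letters added by [prepend] in [opw] never cover what
    follows. *)
Lemma op_head_lev v k x : (0 < k)%N ->
  spanned_by (fun w => head_lev lev w <= lev v)%N (op v k << x >>).
Proof.
elim/ltn_ind: {v}(lev v) {-2}v (erefl (lev v)) x k => l IHl v lv.
move: IHl; rewrite -{}lv => IHl {l}.
elim=> [|[u m] y IHy] k k0; have [le_kv|lt_vk] := leqP k (lev v);
  try by rewrite op_gt //; apply: spanned0.
  by rewrite op_ncovers ?k0 //; apply: spannedU => /=.
have [cov|ncov] := boolP (covers lev v k ((u, m) :: y)); last first.
  by rewrite op_ncovers ?k0 //; apply: spannedU => /=.
have [vu _ kv hm _] := covers_lev hG cov; have lt_uv := gtv_lev hG vu.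
rewrite (op_covers F hG) //; apply: spannedD; first apply: spannedD.
- apply: sol_spanned => [|j x j0]; first by lia.
  by move=> w /(IHl _ lt_uv u erefl x j j0) /leq_trans; apply; apply: ltnW.
- by apply: IHy; rewrite addn_gt0 k0.
apply: spanned_sum => i _ _; apply: (@spanned_linear _ _ _ predT) => // x _.
by rewrite prependE; apply: spannedU => /=.
Qed.

Lemma sol_head_lev u m y i : (0 < lev u <= i)%N ->
  spanned_by (fun w => head_lev lev w <= lev u)%N (sol u m y i).
Proof. by move=> hi; apply: sol_spanned => // k x; apply: op_head_lev. Qed.

Definition normal_of_deg (d : nat) (x : word G) := normal lev x && (wdeg x == d).

Lemma op_normal v k x d : (0 < k <= lev v)%N -> normal_of_deg d x ->
  spanned_by (normal_of_deg (d + k)) (op v k << x >>).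
Proof.
elim/ltn_ind: {v}(lev v) {-2}v (erefl (lev v)) x k d => l IHl v lv.
move: IHl; rewrite -{}lv => IHl {l}; have ncons k x d :
    (0 < k <= lev v)%N -> normal_of_deg d x -> ~~ covers lev v k x ->
    spanned_by (normal_of_deg (d + k)) << (v, k) :: x >>.
  move=> hk /andP[nx /eqP dx] ncov; apply: spannedU.
  by rewrite /normal_of_deg /= hk ncov nx /wdeg /= addnC -dx eqxx.
elim=> [|[u m] y IHy] k d hk nx; first by rewrite op_ncovers //; apply: ncons.
have [cov|ncov] := boolP (covers lev v k ((u, m) :: y)); last first.
  by rewrite op_ncovers //; apply: ncons.
have [vu k0 kv hm _] := covers_lev hG cov; have lt_uv := gtv_lev hG vu.
have [ny dy] : normal lev y /\ (m + wdeg y = d)%N.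
  by case/andP: nx => /and3P[_ _ ny] /eqP <-.
(* The pulse [y] has degree [d - m] and index [lev u - m], and the recurrence raises the degree with
   the index. Earlier terms are zero. *)
have hz i : (lev u - m <= i)%N ->
    spanned_by (normal_of_deg (d + i - lev u)) (sol u m << y >> i).
  elim/ltn_ind: i => j IHj le_j; have [lt_ju|le_uj] := ltnP j (lev u).
    rewrite sol_init //; case: eqP => [-> |_]; last exact: spanned0.
    by apply: spannedU; rewrite /normal_of_deg ny; apply/eqP; lia.
  rewrite sol_rec; last by lia.
  apply/spannedN/spanned_sum => -[k' hk'] _ _ /=.
  have [lt_j|le_j'] := ltnP (j - k'.+1) (lev u - m).
    rewrite sol_init //; last by lia.
    by case: eqP => [e|_]; [lia | rewrite linear0; apply: spanned0].
  have -> : (d + j - lev u = d + (j - k'.+1) - lev u + k'.+1)%N by lia.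
  apply: spanned_linear; last by apply: IHj; [lia | rewrite le_j'].
  by move=> x; apply: (IHl _ lt_uv u erefl).
rewrite (op_covers F hG) //; apply: spannedD; first apply: spannedD.
- have -> : (d + k = d + lev v - lev u)%N by lia.
  by apply: hz; lia.
- have -> : (d + k = wdeg y + (k + m))%N by lia.
  by apply: IHy; [lia | rewrite /normal_of_deg ny eqxx].
apply: spanned_sum => i; rewrite mem_index_iota => /andP[lt_ui lt_iv] _.
(* The heads have level at most [lev u < i], so the prepended letter [(v, lev v - i)] does not cover
   them. *)
have hP : spanned_by (fun w => normal_of_deg (d + i - lev u) w
    && (head_lev lev w <= lev u)%N) (sol u m << y >> i).
  move=> w hw; apply/andP; split; first by apply: hz hw; lia.
  by apply: sol_head_lev hw; lia.
apply: spanned_linear hP => x /andP[nx' hx]; rewrite prependE.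
have -> : (d + k = d + i - lev u + (lev v - i))%N by lia.
by apply: ncons => //; [lia | apply: covers_head_lev; lia].
Qed.

Lemma op_ncovers_lin v k x : (0 < k <= lev v)%N ->
  spanned_by (fun w => head_lev lev w < lev v - k)%N x ->
  op v k x = prepend F v k x.
Proof.
move=> hk hx; rewrite [x]malg_sum !linear_sum /=; apply: eq_big_seq => w /hx hw.
by rewrite !linearZ op_ncovers ?prependE //; apply: covers_head_lev.
Qed.

(** The value of [op v k] on a covered word was chosen to make this hold. As [(u, m)] does not cover
    [y], the term of index [lev u] is minus the word [(u, m) :: y]; on the later terms before
    [lev v] the operators only prepend. *)
Lemma sol_vanishes v u m y : gtv v u -> (0 < m <= lev u)%N ->
  ~~ covers lev u m y ->
  solves_at (lev v) (fun k => op v k) 0%N (sol u m << y >>).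
Proof.
move=> vu hm ncov; rewrite /solves_at add0n; have lt_uv := gtv_lev hG vu.
set z := sol u m << y >>.
have cov : covers lev v (lev v - lev u) ((u, m) :: y).
  by rewrite /= vu hm ncov subnK ?eqxx // ltnW.
rewrite (pulse_sum (E := fun k => op v k) (y := << y >>) (x := << (u, m) :: y >>)
           _ _ lt_uv hm).
- rewrite op0 (op_covers F hG) // -/z.
  have -> : \sum_((lev u).+1 <= i < lev v) op v (lev v - i) (z i)
      = \sum_((lev u).+1 <= i < lev v) prepend F v (lev v - i) (z i).
    apply: eq_big_nat => i /andP[lt_ui lt_iv]; apply: op_ncovers_lin; first lia.
    have hz : spanned_by (fun w => head_lev lev w <= lev u)%N (z i).
      by apply: sol_head_lev; lia.
    by move=> w /hz; lia.
  set c := \sum_(_ <= _ < _) _; set b := op _ _ _; set a := z _.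
  by rewrite [a + b]addrC opprD addrA subrK addrAC subrr.
- by move=> k; apply: linear0.
- by move=> k b; apply: linearN.
- by move=> i lt_iu; apply: sol_init.
- by rewrite /z sol_at_lev // op_ncovers.
Qed.

Lemma solves_uniq u z z' : solves u z -> solves u z' ->
  (forall i, (i < lev u)%N -> z i = z' i) -> z = z'.
Proof.
by move=> hz hz' zz'; apply: funext; apply: solves_eq hz hz' zz'; apply: op0.
Qed.

(** Both sides solve the recurrence of [u] with the same initial terms. *)
Lemma sol_sum u m y i : (0 < m <= lev u)%N ->
  sol u m y i = \sum_(w <- msupp y) y@_w *: sol u m << w >> i.
Proof.
move=> hm; have u0 : (0 < lev u)%N by lia.
suff -> : sol u m y = fun i => \sum_(w <- msupp y) y@_w *: sol u m << w >> i by [].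
apply: solves_uniq => [||{}i lt_iu]; first exact: sol_solves.
  by move=> j; apply: solves_at_sum => w _; apply: solves_atZ; apply: sol_solves.
rewrite sol_init //; under eq_bigr do rewrite sol_init //.
by case: eqP => _; [exact: malg_sum | rewrite big1 // => w _; exact: scaler0].
Qed.

(** * Inductive step at [v], the claim being known at lower levels *)

Section Step.
Variable v : vertex G.
Hypothesis IHv : forall u, (lev u < lev v)%N ->
  forall t z, gtv u t -> solves t z -> solves u z.
Local Notation vanishes := (solves_at (lev v) (fun k => op v k) 0%N).

(** If [(u, k)] covers [x = (t, m) :: y], the solution of [t] with pulse [y] also solves [u] by
    induction. Then [sol u k x] is a combination of it and of solutions of [u] whose pulses are
    shorter or not covered. *)
Lemma sol_covers_vanishes u k x : gtv v u -> (0 < k <= lev u)%N ->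
  vanishes (sol u k << x >>).
Proof.
move=> vu; have lt_uv := gtv_lev hG vu.
elim: x k => [|[t m] y IHy] k hk; first exact: sol_vanishes.
have [cov|ncov] := boolP (covers lev u k ((t, m) :: y)); last exact: sol_vanishes.
have [ut _ kt hm ncov] := covers_lev hG cov; have lt_tu := gtv_lev hG ut.
set z := sol t m << y >>; have t0 : (0 < lev t)%N by lia.
have u0 : (0 < lev u)%N by lia.
have z_solves : solves u z by apply: IHv ut _ => //; apply: sol_solves.
(* By comparison of initial terms: [- z] supplies the pulse [x] at index [lev t = lev u - k], and
   the other summands cancel the rest of [- z] below [lev u]. *)
have -> : sol u k << (t, m) :: y >> =
    (fun i => - z i + (sol u (k + m) << y >> i +
       \sum_(j <- index_iota (lev t).+1 (lev u)) sol u (lev u - j) (z j) i)).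
  apply: solves_uniq => [||i lt_iu].
  - by apply: sol_solves; lia.
  - move=> i; apply: solves_atD; first exact/solves_atN/z_solves.
    apply: solves_atD; first exact: sol_solves.
    by apply: solves_at_sum => j _; apply: sol_solves.
  rewrite !sol_init; try lia.
  have -> : \sum_(j <- index_iota (lev t).+1 (lev u)) sol u (lev u - j) (z j) i =
      if (lev t < i)%N then z i else 0.
    transitivity (\sum_((lev t).+1 <= j < lev u | j == i) z j).
      rewrite [RHS]big_mkcond; apply: eq_big_nat => j hj.
      rewrite sol_init; try lia.
      by congr (if _ then _ else _); apply/eqP/eqP; lia.
    case: ltnP => hti; last by rewrite big_nat_cond big1 // => j; lia.
    by rewrite big_nat1_eq hti lt_iu.
  have -> : (lev u - k = lev t)%N by lia.
  have -> : (lev u - (k + m) = lev t - m)%N by lia.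
  case: (ltngtP (lev t) i) => [lt_ti|lt_it|<-].
  - case: eqP => [|_]; first by lia.
    by rewrite add0r addNr.
  - by rewrite /z sol_init // addr0 addNr.
  case: eqP => [|_]; first by lia.
  by rewrite /z sol_at_lev // op_ncovers // opprK !addr0.
apply: solves_atD; first exact/solves_atN/sol_vanishes/ncov/hm/(gtv_trans vu ut).
apply: solves_atD; first by apply: IHy; lia.
apply: solves_at_sum => j; rewrite mem_index_iota => /andP[lt_tj lt_ju].
have -> : sol u (lev u - j) (z j) =
    (fun i => \sum_(w <- msupp (z j)) (z j)@_w *: sol u (lev u - j) << w >> i).
  by apply: funext => i; apply: sol_sum; lia.
apply: solves_at_sum => w hw; apply/solves_atZ/sol_vanishes => //; first by lia.
apply: covers_head_lev; have := sol_head_lev _ hw; lia.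
Qed.

(** A solution is the sum of the solutions for its single initial terms, split further into
    words. *)
Lemma solves_vanishes u z : gtv v u -> solves u z -> vanishes z.
Proof.
move=> vu hz; have [u0|u0] := posnP (lev u).
  have -> : z = fun=> 0; last exact: solves_at0.
  apply: funext => i; have := hz i.
  by rewrite /solves_at u0 big_ord1 op0 addn0 subn0.
have -> : z = fun i => \sum_(j <- index_iota 0 (lev u))
    \sum_(w <- msupp (z j)) (z j)@_w *: sol u (lev u - j) << w >> i.
  apply: (solves_uniq hz) => [|i lt_iu].
    move=> i; apply: solves_at_sum => j _; apply: solves_at_sum => w _.
    by apply: solves_atZ; apply: sol_solves.
  transitivity (\sum_(0 <= j < lev u | j == i) z j).
    by rewrite big_nat1_eq lt_iu.
  rewrite [LHS]big_mkcond; apply: eq_big_nat => j hj.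
  rewrite -sol_sum; last by lia.
  rewrite sol_init; try lia.
  by congr (if _ then _ else _); apply/eqP/eqP; lia.
apply: solves_at_sum => j; rewrite mem_index_iota => hj.
apply: solves_at_sum => w _; apply/solves_atZ/sol_covers_vanishes => //; lia.
Qed.

End Step.

(** A shift of the solution reduces every index to 0. *)
Lemma op_solves v u z : gtv v u -> solves u z -> solves v z.
Proof.
elim/ltn_ind: {v}(lev v) {-2}v (erefl (lev v)) u z => l IHl v lv u z vu hz i.
rewrite -[i]addn0 -solves_at_shift.
apply: (@solves_vanishes v) vu (solves_shift i hz) => t lt_tv s y.
by apply: (IHl (lev t)); rewrite // -lv.
Qed.

(** This is P_v = (tau - e) P_u with [e] acting as [op u 1 - op v 1]. The defects [D j] satisfy: the
    sum of [D j (z (lev u - j))] is 0 for the solution [z] of [u]. With a pulse [x], only [D k x] is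
    left. *)
Lemma op_edge e k x : op (tail_of e) k.+1 x =
  op (head_of e) k.+1 x
    - (op (head_of e) 1 (op (head_of e) k x) - op (tail_of e) 1 (op (head_of e) k x)).
Proof.
set v := tail_of e; set u := head_of e.
have lvu : lev v = (lev u).+1 by apply: hG.2.
pose D j (y : M) := op v j.+1 y - op u j.+1 y + (op u 1 (op u j y) - op v 1 (op u j y)).
suff D0 : D k x = 0.
  by apply/eqP; rewrite -subr_eq0 opprB addrA addrAC; apply/eqP.
have [lt_uk|le_ku] := ltnP (lev u) k.
  have gt0 w j : (lev w < j)%N -> op w j x = 0 by apply: op_gt.
  by rewrite /D !gt0 ?linear0 ?subrr ?addr0 //; lia.
have [->|k0] := posnP k; first by rewrite /D !op0 addrA subrK subrr.
have hz : solves u (sol u k x) by apply: sol_solves; lia.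
set z := sol u k x in hz.
(* The recurrences of [v] at 0 and of [u] at 1 share the term [z (lev v)]; that of [u] at 0 disposes
   of the products in [D]. *)
have hv : z (lev v) + \sum_(j < lev v) op v j.+1 (z (lev v - j.+1)%N) = 0.
  have := op_solves (gtv_edge e) hz 0%N.
  by rewrite /solves_at big_ord_recl op0 subn0.
have hu : z (lev v) + \sum_(j < lev v) op u j.+1 (z (lev v - j.+1)%N) = 0.
  have := hz 1%N; rewrite /solves_at big_ord_recl op0 lvu big_ord_recr /= subn0.
  by rewrite [op u (lev u).+1 _]op_gt // addr0.
have hu0 : \sum_(j < lev v) op u j (z (lev u - j)%N) = 0 by rewrite lvu; apply: hz 0.
have : \sum_(j < lev v) D j (z (lev u - j)%N) = 0.
  have hw w : \sum_(j < lev v) op w 1 (op u j (z (lev u - j)%N)) = 0.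
    by rewrite -linear_sum hu0 linear0.
  rewrite /D big_split /= !sumrB !hw subrr addr0.
  have hS w : \sum_(j < lev v) op w j.+1 (z (lev u - j)%N) =
      \sum_(j < lev v) op w j.+1 (z (lev v - j.+1)%N).
    by apply: eq_bigr => j _; congr (op _ _ (z _)); lia.
  apply/eqP; rewrite subr_eq0 !hS; apply/eqP/(addrI (z (lev v))).
  by rewrite hv hu.
have lt_kv : (k < lev v)%N by lia.
rewrite (bigD1 (Ordinal lt_kv)) //= [z _]sol_init; try lia.
rewrite eqxx big1 ?addr0 // => -[j lt_jv] /eqP ne_jk /=.
have [->|j0] := posnP j; first by rewrite /D !op0 addrA subrK subrr.
rewrite /z sol_init; try lia.
case: eqP => [e_jk|_]; last by rewrite /D !linear0 !addr0.
by case: ne_jk; apply: val_inj => /=; lia.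
Qed.

End OperatorModule.

(** * The action of the free algebra on words *)

Lemma is_path_cons (G : digraph) (v w : vertex G) e q : is_path v w (e :: q) ->
  tail_of e = v /\ (q = [::] /\ head_of e = w \/ is_path (head_of e) w q).
Proof.
case/and3P=> /eqP -> pq /eqP lq; split=> //.
case: q pq lq => [|e' q] /= pq lq; first by left.
by right; case/andP: pq => -> ->; rewrite lq eqxx.
Qed.

(** * Coefficients of the polynomial of a path *)

Section PathCoefficients.
Variables (F : fieldType) (G : digraph).
Local Notation T := (free_alg F G).
Implicit Type p : seq (edge G).

Lemma coef_path_polyS p i : (size p < i)%N -> (path_poly F p)`_i = 0.
Proof.
rewrite /path_poly; elim: p i => [|e p IHp] [|i] //= hi.
  by rewrite big_nil coef1.
rewrite big_cons mulrBl coefB coefXM coefCM /= !IHp ?mulr0 ?subrr //.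
exact: ltnW.
Qed.

Lemma coef_path_poly_size p : (path_poly F p)`_(size p) = 1.
Proof.
elim: p => [|e p IHp]; first by rewrite /path_poly big_nil coef1.
rewrite /path_poly big_cons mulrBl coefB coefXM coefCM /= IHp.
by rewrite coef_path_polyS // mulr0 subr0.
Qed.

(** Beyond the length of the path, truncated subtraction makes [path_coef] repeat the constant
    coefficient; here the value is 0. *)
Definition pcoef p k : T := if (k <= size p)%N then path_coef F p k else 0.

Lemma pcoef0 p : pcoef p 0 = 1.
Proof. by rewrite /pcoef /path_coef subn0 coef_path_poly_size. Qed.

Lemma pcoef_nil k : pcoef [::] k.+1 = 0.
Proof. by []. Qed.

Lemma pcoef_cons e p k :
  pcoef (e :: p) k.+1 = pcoef p k.+1 - edge_gen F e * pcoef p k.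
Proof.
rewrite /pcoef /= ltnS; have [le_kp|lt_pk] := leqP k (size p); last first.
  by rewrite ltnNge ltnW // mulr0 subrr.
rewrite /path_coef /= subSS /path_poly big_cons mulrBl coefB coefXM coefCM.
have [lt_kp|le_pk] := ltnP k (size p).
  by rewrite subn_eq0 leqNgt lt_kp -subnS.
have -> : k = size p by apply/eqP; rewrite eqn_leq le_kp le_pk.
by rewrite subnn.
Qed.

Lemma homogeneous_sub d (x y : T) :
  homogeneous d x -> homogeneous d y -> homogeneous d (x - y).
Proof.
by move=> hx hy m /(fsubsetP (msuppB_le x y)); rewrite inE => /orP[/hx|/hy].
Qed.

Lemma homogeneous_mul c d (x y : T) :
  homogeneous c x -> homogeneous d y -> homogeneous (c + d) (x * y).
Proof.
by move=> hx hy m /msuppM_le[m1 [m2 [/hx <- /hy <- ->]]]; rewrite fdegM.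
Qed.

Lemma homogeneous1 : homogeneous 0 (1 : T).
Proof. by move=> m; rewrite msuppU oner_eq0 inE => /eqP ->; apply: fdeg1. Qed.

Lemma homogeneous_pcoef p k : homogeneous k (pcoef p k).
Proof.
elim: p k => [|e p IHp] [|k]; try by rewrite pcoef0; apply: homogeneous1.
  by rewrite pcoef_nil => m; rewrite msupp0.
rewrite pcoef_cons; apply: homogeneous_sub; first exact: IHp.
rewrite -add1n; apply: homogeneous_mul (IHp k) => m.
by rewrite msuppU oner_eq0 inE => /eqP ->; apply: fdegU.
Qed.

End PathCoefficients.

(** * The span of words as a left module over the free algebra *)

Section Action.
Variables (F : fieldType) (G : digraph) (lev : vertex G -> nat) (n : nat).
Hypothesis hG : layering n lev.
Local Notation M := {malg F[word G]}.
Local Notation T := (free_alg F G).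
Local Notation op := (@op G lev F).

(** Comparing the first coefficients in P_v = (tau - e) P_u gives e = e(u, 1) - e(v, 1). *)
Definition edge_act (e : edge G) : {linear M -> M} :=
  op (head_of e) 1 \- op (tail_of e) 1.

Definition act (x : T) (m : M) : M :=
  lin_ext (fun w : {fmonom (edge G)} => foldr (fun e => edge_act e) m w) x.

Lemma actE x m : act x m = \sum_(w <- msupp x) x@_w *: foldr (fun e => edge_act e) m w.
Proof. exact: lin_extE. Qed.

Lemma actB x y m : act (x - y) m = act x m - act y m.
Proof. exact: linearB. Qed.

Lemma actZ c x m : act (c *: x) m = c *: act x m.
Proof. exact: linearZ. Qed.

Lemma act_sum (I : Type) (r : seq I) (x : I -> T) m :
  act (\sum_(i <- r) x i) m = \sum_(i <- r) act (x i) m.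
Proof. exact: linear_sum. Qed.

Lemma act0 m : act 0 m = 0.
Proof. exact: linear0. Qed.

Lemma malgUZ (K : choiceType) (c : F) (k : K) :
  << c *g k >> = c *: << k >> :> {malg F[K]}.
Proof. by apply/malgP => k'; rewrite mcoeffZ !mcoeffU mulrnAr mulr1. Qed.

Lemma actU c w m : act << c *g w >> m = c *: foldr (fun e => edge_act e) m w.
Proof. by rewrite /act malgUZ linearZ /= lin_extU. Qed.

Lemma act_edge e m : act (edge_gen F e) m = edge_act e m.
Proof. by rewrite actU scale1r fmuE. Qed.

Lemma act1 m : act 1 m = m.
Proof. by rewrite actU scale1r fm1. Qed.

Lemma foldr_edge_act_sum (I : Type) (r : seq I) (c : I -> F) (m : I -> M) w :
  foldr (fun e => edge_act e) (\sum_(i <- r) c i *: m i) w =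
  \sum_(i <- r) c i *: foldr (fun e => edge_act e) (m i) w.
Proof.
elim: w => [//|e w IHw].
transitivity (edge_act e (\sum_(i <- r) c i *: foldr (fun e => edge_act e) (m i) w)).
  by rewrite -IHw.
by rewrite linear_sum; apply: eq_bigr => i _; apply: linearZ.
Qed.

Lemma actM x y m : act (x * y) m = act x (act y m).
Proof.
rewrite malgME act_sum [RHS]actE; apply: eq_bigr => w1 _.
rewrite [act y m]actE foldr_edge_act_sum scaler_sumr act_sum; apply: eq_bigr => w2 _.
by rewrite actU scalerA fmM foldr_cat.
Qed.

Lemma act_0r x : act x 0 = 0.
Proof.
rewrite actE big1 // => w _.
rewrite (_ : foldr _ _ _ = 0) ?scaler0 //.
elim: (w : seq _) => [//|e s IHs].
by transitivity (edge_act e 0); [rewrite -{2}IHs | exact: linear0].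
Qed.

(** Iteration of [op_edge]: P_v is the path polynomial times P_w. The first alternative is the empty
    path, which [is_path] excludes. *)
Lemma op_path v w p k m : v = w /\ p = [::] \/ is_path v w p ->
  op v k m = \sum_(j < k.+1) act (pcoef F p j) (op w (k - j)%N m).
Proof.
have nilE u j (y : M) : op u j y =
    \sum_(i < j.+1) act (pcoef F [::] i) (op u (j - i)%N y).
  rewrite big_ord_recl pcoef0 act1 subn0 big1 ?addr0 // => i _.
  by rewrite pcoef_nil act0.
elim: p v k m => [|e q IHq] v k m; first by case=> [[-> _]|].
case=> [[]//|/is_path_cons[<- hq]].
have {hq}hq : head_of e = w /\ q = [::] \/ is_path (head_of e) w q.
  by case: hq => [[-> ->]|]; [left | right].
case: k => [|k]; first by rewrite big_ord1 pcoef0 act1 !op0.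
transitivity (op (head_of e) k.+1 m - edge_act e (op (head_of e) k m)).
  exact: (op_edge hG).
rewrite (IHq _ k.+1 m hq) -act_edge [op _ k m](IHq _ k m hq).
have -> : act (edge_gen F e) (\sum_(j < k.+1) act (pcoef F q j) (op w (k - j)%N m))
    = \sum_(j < k.+1) act (edge_gen F e * pcoef F q j) (op w (k - j)%N m).
  rewrite act_edge linear_sum; apply: eq_bigr => j _.
  by rewrite actM act_edge.
rewrite !(big_ord_recl k.+1) !pcoef0 -addrA -sumrB; congr (_ + _).
by apply: eq_bigr => j _; rewrite pcoef_cons actB subSS.
Qed.

(** Expand [op v j] along both paths. By induction on [j] all terms but the last agree, and in the
    last one [op w 0] is the identity. *)
Lemma relator_act x : relator x -> forall m, act x m = 0.
Proof.
case=> v [w [p1 [p2 [k [hp1 hp2 /andP[_ hk] ->]]]]] m.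
have e12 : size p1 = size p2.
  by have := is_path_lev hG hp1; rewrite (is_path_lev hG hp2); lia.
suff h j m' : act (pcoef F p1 j) m' = act (pcoef F p2 j) m'.
  by have := h k m; rewrite actB /pcoef -e12 hk => ->; apply: subrr.
elim/ltn_ind: j m' => j IHj m'.
have := op_path j m' (or_intror hp1); rewrite (op_path j m' (or_intror hp2)).
rewrite !big_ord_recr subnn !op0 /=.
under eq_bigr => i _ do rewrite -IHj //.
by move=> h; apply: (addrI _ (esym h)).
Qed.

(** The elements acting as zero form a two-sided ideal. *)
Lemma ideal_act x : ideal_gen (@relator F G) x -> forall m, act x m = 0.
Proof.
move=> gx; apply: (gx (fun x => forall m, act x m = 0)); last exact: relator_act.
split=> [m|x1 y hx hy m|a y hy m|a y hy m]; rewrite ?act0 //.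
- by rewrite actB hx hy subrr.
- by rewrite actM hy act_0r.
- by rewrite actM hy.
Qed.

End Action.

(** * A basis of the graph algebra *)

Lemma malg_scaleAr (K : monomType) (R : comNzRingType) (c : R) (x y : {malg R[K]}) :
  x * (c *: y) = c *: (x * y).
Proof.
apply/malgP => k; rewrite mcoeffZ (mcoeffMlw k (fsubset_refl _) (msuppZ_le c y)).
rewrite mcoeffMl mulr_sumr; apply: eq_bigr => k1 _; rewrite mulr_sumr.
by apply: eq_bigr => k2 _; rewrite mcoeffZ mulrCA mulrnAr.
Qed.

(** * Evaluation of words in any module with operators obeying the edge relations *)

Section GraphModule.
Variables (F : fieldType) (G : digraph) (lev : vertex G -> nat) (n : nat).
Hypothesis hG : layering n lev.
Local Notation M := {malg F[word G]}.
Local Notation op := (@op G lev F).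
Local Notation sol := (@sol G lev F).

Variables (N : lmodType F) (E : vertex G -> nat -> {linear N -> N}).
Variable B : edge G -> {linear N -> N}.
Hypothesis E0 : forall v x, E v 0%N x = x.
Hypothesis E_gt : forall v k x, (lev v < k)%N -> E v k x = 0.
Hypothesis E_edge : forall e k x,
  E (tail_of e) k.+1 x = E (head_of e) k.+1 x - B e (E (head_of e) k x).
Local Notation solvesN u := (solves (lev u) (fun k => E u k)).

(** The recurrence of the tail at [i] is that of the head at [i.+1] minus [B e] applied to that of
    the head at [i]. *)
Lemma solves_edge e (z : nat -> N) : solvesN (head_of e) z -> solvesN (tail_of e) z.
Proof.
set v := tail_of e; set u := head_of e => hz i.
have hlev : lev v = (lev u).+1 by apply: hG.2.
rewrite hlev /solves_at big_ord_recl E0 subn0.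
under eq_bigr => k _ do rewrite E_edge.
rewrite sumrB addrA -linear_sum.
have -> : \sum_(k < (lev u).+1) E u k (z (i + (lev u).+1 - lift ord0 k)%N) = 0.
  by rewrite -[RHS](hz i); apply: eq_bigr => k _; rewrite addnS subSS.
rewrite linear0 subr0 big_ord_recr /= E_gt // addr0.
have := hz i.+1; rewrite /solves_at big_ord_recl E0 subn0.
by rewrite addSnnS.
Qed.

Lemma solves_gtv v u (z : nat -> N) : gtv v u -> solvesN u z -> solvesN v z.
Proof.
case/asboolP=> p hp hz; elim: p v hp => // e p IHp v /is_path_cons[<- [[_ hu]|/IHp]];
  apply: solves_edge.
by rewrite hu.
Qed.

Variable x0 : N.

Definition word_act (x : word G) : N := foldr (fun b => E b.1 b.2) x0 x.
Definition theta (m : M) : N := lin_ext word_act m.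

HB.instance Definition _ :=
  GRing.isLinear.Build F M N *:%R theta (lin_ext_is_linear word_act).

Lemma thetaD x y : theta (x + y) = theta x + theta y.
Proof. exact: linearD. Qed.

Lemma thetaU x : theta << x >> = word_act x.
Proof. exact: lin_extU. Qed.

Lemma theta_cons v k x : theta << (v, k) :: x >> = E v k (theta << x >>).
Proof. by rewrite !thetaU. Qed.

Lemma theta_prepend v k x : theta (prepend F v k x) = E v k (theta x).
Proof.
apply: (linear_malg_eq (f := theta \o prepend F v k) (h := E v k \o theta)).
by move=> w /=; rewrite prependE theta_cons.
Qed.

(** On a covered word, the image of [sol u m y] solves [u] by induction, hence [v]; the recurrence
    of [v] at 0 is then the image of the identity defining [op v k]. *)
Lemma theta_op v k x : theta (op v k x) = E v k (theta x).
Proof.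
elim/ltn_ind: {v}(lev v) {-2}v (erefl (lev v)) k x => l IHl v lv k x.
move: IHl; rewrite -{}lv => IHl {l}.
apply: (linear_malg_eq (f := theta \o op v k) (h := E v k \o theta)) => {}x.
rewrite [LHS]/= [RHS]/=; elim: x k => [|[u m] y IHy] k.
all: have [->|k0] := posnP k; first by rewrite op0 E0.
all: have [le_kv|lt_vk] := leqP k (lev v);
  last by rewrite op_gt // E_gt //; apply: linear0.
  by rewrite op_ncovers ?k0 // theta_cons.
have [cov|ncov] := boolP (covers lev v k ((u, m) :: y)); last first.
  by rewrite op_ncovers ?k0 // theta_cons.
have [vu _ kv hm ncov] := covers_lev hG cov; have lt_uv := gtv_lev hG vu.
have u0 : (0 < lev u)%N by lia.
set z := sol u m << y >>.
have hz : solvesN u (fun i => theta (z i)).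
  move=> i; rewrite /solves_at.
  under eq_bigr => j _ do rewrite -(IHl _ lt_uv u erefl).
  have zi : \sum_(j < (lev u).+1) op u j (z (i + lev u - j)%N) = 0 by apply: sol_solves.
  by rewrite -linear_sum zi linear0.
have := solves_gtv vu hz 0%N; rewrite /solves_at add0n.
rewrite (pulse_sum (E := fun k => E v k) (z := fun i => theta (z i))
           (y := theta << y >>) (x := theta << (u, m) :: y >>) _ _ lt_uv hm).
- have -> : (lev v - lev u = k)%N by lia.
  have theta_sum : theta (\sum_((lev u).+1 <= i < lev v) prepend F v (lev v - i) (z i)) =
      \sum_((lev u).+1 <= i < lev v) E v (lev v - i) (theta (z i)).
    by rewrite linear_sum; apply: eq_bigr => i _; apply: theta_prepend.
  rewrite E0 -IHy (op_covers F hG) // -/z !thetaD theta_sum.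
  set c := \sum_(_ <= _ < _) _; set b := theta (op _ _ _); set d := theta (z _).
  move=> h; apply/eqP; rewrite -subr_eq0 -[X in _ == X]h; apply/eqP.
  by rewrite [d + b]addrC addrAC [b + d - _]addrAC [LHS]addrAC.
- by move=> j; apply: linear0.
- by move=> j b; apply: linearN.
- by move=> i lt_iu; rewrite /z sol_init //; case: eqP => // _; apply: linear0.
- by rewrite /z sol_at_lev // op_ncovers // linearN.
Qed.

End GraphModule.

Section QuotientMaps.
Variables (F : fieldType) (T : lalgType F) (S : T -> Prop).

Lemma to_quot_is_linear : linear (to_quot S).
Proof. by move=> c x y; rewrite to_quotD to_quotZ. Qed.

HB.instance Definition _ :=
  GRing.isLinear.Build F T (quot_alg S) *:%R (to_quot S) to_quot_is_linear.

Lemma to_quot_scale c x : to_quot S (c *: x) = c *: to_quot S x.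
Proof. exact: to_quotZ. Qed.

Lemma to_quot_mul x y : to_quot S (x * y) = to_quot S x * to_quot S y.
Proof. exact: to_quotM. Qed.

Lemma to_quot_gen x : S x -> to_quot S x = 0.
Proof.
move=> Sx; rewrite -(linear0 (to_quot S)); apply/to_quot_eq.
by rewrite subr0 => I _; apply.
Qed.

Hypothesis T_scaleAr : forall c (x y : T), x * (c *: y) = c *: (x * y).

Lemma quot_scaleAr c (x y : quot_alg S) : x * (c *: y) = c *: (x * y).
Proof.
rewrite -[x]of_quotK -[y]of_quotK -to_quot_scale -!to_quot_mul T_scaleAr.
exact: to_quot_scale.
Qed.

End QuotientMaps.

Section LeftMultiplication.
Variables (F : fieldType) (G : digraph).

Definition lmul (a x : graph_alg F G) : graph_alg F G := a * x.

Lemma lmul_is_linear a : linear (lmul a).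
Proof.
move=> c x y; rewrite /lmul mulrDr; congr (_ + _).
by apply: quot_scaleAr; apply: malg_scaleAr.
Qed.

HB.instance Definition _ a :=
  GRing.isLinear.Build F (graph_alg F G) (graph_alg F G) *:%R (lmul a) (lmul_is_linear a).

End LeftMultiplication.

(** * Normal words form a basis of the graph algebra *)

Section Intertwining.
Variables (F : fieldType) (G : digraph) (lev : vertex G -> nat) (n : nat).
Hypothesis hG : layering n lev.
Variable star : vertex G.
Hypothesis lev_star : lev star = 0%N.
Variable sp : vertex G -> seq (edge G).
Hypothesis hsp : forall v, v = star /\ sp v = [::] \/ is_path v star (sp v).
Local Notation M := {malg F[word G]}.
Local Notation T := (free_alg F G).
Local Notation A := (graph_alg F G).
Local Notation q := (to_quot (@relator F G)).
Local Notation op := (@op G lev F).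
Local Notation sol := (@sol G lev F).
Local Notation act := (@act F G lev).
Local Notation edge_act := (@edge_act F G lev).

(** A lift of e(v, k) to the free algebra, along the chosen path [sp v] from [v] to [star]. *)
Definition vgen v k : T := pcoef F (sp v) k.
Definition vgen_quot v k : A := q (vgen v k).
Local Notation a := vgen_quot.

Lemma size_sp v : size (sp v) = lev v.
Proof.
case: (hsp v) => [[-> ->]|]; first by rewrite lev_star.
by move/(is_path_lev hG); rewrite lev_star addn0.
Qed.

(** As [star] has level 0, only the last term of [op_path] survives. *)
Lemma vgen_act v k m : act (vgen v k) m = op v k m.
Proof.
rewrite (op_path hG k m (hsp v)) big_ord_recr /= subnn op0.
rewrite big1 ?add0r // => i _; rewrite op_gt ?act_0r //.
by rewrite lev_star subn_gt0.
Qed.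

Lemma vgen_quot0 v : a v 0 = 1.
Proof. by rewrite /vgen_quot /vgen pcoef0. Qed.

Lemma vgen_quot_gt v k : (lev v < k)%N -> a v k = 0.
Proof.
by rewrite /vgen_quot /vgen /pcoef size_sp ltnNge => /negbTE ->; exact: linear0.
Qed.

(** The chosen path of the tail and the edge followed by the chosen path of the head have the same
    endpoints, so a relator identifies their coefficients. *)
Lemma vgen_quot_edge e k : a (tail_of e) k.+1 =
  a (head_of e) k.+1 - q (edge_gen F e) * a (head_of e) k.
Proof.
rewrite -to_quot_mul -linearB -pcoef_cons; apply/eqP.
rewrite -subr_eq0 -linearB; apply/eqP.
have hp : is_path (tail_of e) star (e :: sp (head_of e)).
  rewrite /= eqxx; case: (hsp (head_of e)) => [[hu ->]|]; first by rewrite /= hu eqxx.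
  by case: (sp _) => //= e' p /and3P[-> -> ->].
have hlev : lev (tail_of e) = (lev (head_of e)).+1 by apply: hG.2.
case: (hsp (tail_of e)) => [[e_star _]|ht].
  by move: hlev; rewrite e_star lev_star.
have [le_k|lt_k] := leqP k.+1 (lev (tail_of e)); last first.
  rewrite /vgen /pcoef /= !size_sp -hlev leqNgt lt_k subrr; exact: linear0.
apply: to_quot_gen.
exists (tail_of e), star, (sp (tail_of e)), (e :: sp (head_of e)), k.+1.
by rewrite /vgen /pcoef /= !size_sp -hlev le_k.
Qed.

Lemma edge_quot e : q (edge_gen F e) = a (head_of e) 1 - a (tail_of e) 1.
Proof. by rewrite vgen_quot_edge vgen_quot0 mulr1 opprB addrC subrK. Qed.

Local Notation thetaA := (theta (fun v k => lmul (a v k)) 1).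

Lemma quot_theta_op v k x : thetaA (op v k x) = a v k * thetaA x.
Proof.
apply: (theta_op hG (B := fun e => lmul (q (edge_gen F e)))).
- by move=> u y; rewrite -[LHS]/(a u 0 * y) vgen_quot0 mul1r.
- by move=> u j y lt_uj; rewrite -[LHS]/(a u j * y) vgen_quot_gt // mul0r.
move=> e j y; rewrite -[LHS]/(a (tail_of e) j.+1 * y) vgen_quot_edge mulrBl.
by rewrite -mulrA.
Qed.

Lemma quot_theta_edge_act e x : thetaA (edge_act e x) = q (edge_gen F e) * thetaA x.
Proof.
transitivity (thetaA (op (head_of e) 1 x) - thetaA (op (tail_of e) 1 x)).
  exact: linearB.
by rewrite !quot_theta_op -mulrBl edge_quot.
Qed.

(** Evaluation turns the action into left multiplication and sends the empty word to 1. Spanning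
    follows from this. *)
Lemma quot_theta_act x : q x = thetaA (act x << [::] : word G >>).
Proof.
suff hU (w : {fmonom (edge G)}) : q << w >> = thetaA (act << w >> << [::] : word G >>).
  rewrite {1}[x]malg_sum actE !linear_sum; apply: eq_bigr => w _.
  rewrite !linearZ /=; congr (_ *: _).
  by rewrite hU actU scale1r.
rewrite actU scale1r; case: w; elim=> [|e s IHs].
  rewrite [foldr _ _ _]/= thetaU /word_act /= -fmoneE //.
have -> : << FMonom (e :: s) >> = edge_gen F e * << FMonom s >> :> T.
  rewrite malgM_def fgmulUU mulr1; congr mkmalgU.
  by apply: val_inj; rewrite /= fmM fmU.
by rewrite [foldr _ _ _]/= quot_theta_edge_act -IHs -to_quot_mul.
Qed.

Definition vprod (x : word G) : T := \prod_(b <- x) vgen b.1 b.2.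

Lemma quot_vprod x : q (vprod x) = thetaA << x >>.
Proof.
rewrite thetaU; elim: x => [|b x IHx]; first by rewrite /vprod big_nil.
by rewrite /vprod big_cons to_quot_mul IHx.
Qed.

Lemma vprod_act x : normal lev x -> act (vprod x) << [::] : word G >> = << x >>.
Proof.
elim: x => [_|[v k] x IHx /= /and3P[hk ncov nx]]; first by rewrite /vprod big_nil act1.
by rewrite /vprod big_cons actM IHx // vgen_act op_ncovers.
Qed.

Lemma homogeneous_vprod x : homogeneous (wdeg x) (vprod x).
Proof.
elim: x => [|b x IHx]; first by rewrite /vprod big_nil; apply: homogeneous1.
by rewrite /vprod big_cons; apply: homogeneous_mul IHx; apply: homogeneous_pcoef.
Qed.

Lemma edge_act_normal d e x : spanned_by (normal_of_deg lev d) x ->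
  spanned_by (normal_of_deg lev d.+1) (edge_act e x).
Proof.
move=> hx; have hv v : spanned_by (normal_of_deg lev d.+1) (op v 1 x).
  have [le_v|lt_v] := leqP 1 (lev v); last by rewrite op_gt //; apply: spanned0.
  apply: spanned_linear hx => w nw; rewrite -(addn1 d).
  exact: (op_normal hG _ nw).
by apply: spannedD (hv _) _; apply: spannedN.
Qed.

Lemma act_normal d x : homogeneous d x ->
  spanned_by (normal_of_deg lev d) (act x << [::] : word G >>).
Proof.
move=> hx; rewrite actE; apply: spanned_sum => w /hx <- _; apply: spannedZ.
rewrite fdegE; elim: (w : seq _) => [|e s IHs]; first exact: spannedU.
exact: edge_act_normal.
Qed.

Lemma spanned_uniq_sum (s : seq (word G)) (y : M) : uniq s ->
  spanned_by (fun x => x \in s) y -> y = \sum_(w <- s) y@_w *: << w >>.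
Proof.
move=> us hy; apply/malgP => x; rewrite raddf_sum /=.
under eq_bigr => w _ do rewrite mcoeffZ mcoeffU.
have [xs|xs] := boolP (x \in s).
  rewrite (bigD1_seq x) //= eqxx mulr1 big1 ?addr0 // => w /negbTE ->.
  by rewrite mulr0.
rewrite mcoeff_outdom; last by apply: contra xs => /hy.
rewrite big_seq big1 // => w ws; case: eqP => [e|_]; last by rewrite mulr0.
by rewrite -e ws in xs.
Qed.

Lemma graded_piece_basis d (s : seq (word G)) : uniq s ->
  (forall x, (x \in s) = normal_of_deg lev d x) ->
  @is_basis F A (@graded_piece F G d) (size s) (fun i => thetaA << nth [::] s i >>).
Proof.
move=> us hs; have hs_nth (i : 'I_(size s)) : normal_of_deg lev d (nth [::] s i).
  by rewrite -hs mem_nth.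
split.
- move=> i; case/andP: (hs_nth i) => _ /eqP di.
  exists (vprod (nth [::] s i)); last by rewrite quot_vprod.
  by rewrite -di; apply: homogeneous_vprod.
(* Independence: a vanishing combination lifts to an element of the ideal, which sends the empty
   word both to 0 and to the combination of the words. *)
- move=> c sum0 i; pose x : T := \sum_i c i *: vprod (nth [::] s i).
  have qx0 : q x = q 0.
    rewrite linear0 -[RHS]sum0 linear_sum; apply: eq_bigr => j _.
    by rewrite -quot_vprod; apply: to_quot_scale.
  have := ideal_act hG ((to_quot_eq _ _ _).1 qx0) << [::] : word G >>.
  rewrite subr0 act_sum => /(congr1 (mcoeff (nth [::] s i))).
  rewrite raddf_sum mcoeff0 (bigD1 i) //= big1 ?addr0 => [|j ne_ji].
    rewrite actZ vprod_act; last by case/andP: (hs_nth i).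
    by rewrite mcoeffZ mcoeffUU mulr1.
  rewrite actZ vprod_act; last by case/andP: (hs_nth j).
  by rewrite mcoeffZ mcoeffU nth_uniq // (inj_eq val_inj) (negbTE ne_ji) mulr0.
- move=> _ [x hx ->]; rewrite quot_theta_act; set y := act x _.
  exists (fun i => y@_(nth [::] s i)).
  have hy : spanned_by (fun w => w \in s) y.
    by move=> w /(act_normal hx); rewrite hs.
  rewrite {1}(spanned_uniq_sum us hy) linear_sum (big_nth [::]) big_mkord.
  by apply: eq_bigr => i _; apply: linearZ.
Qed.

End Intertwining.

(** * Counting normal words *)

Section Dimension.
Variables (F : fieldType) (V : lmodType F) (U : V -> Prop).

(** The coordinates of [b'] with respect to [b] form a matrix with independent rows. *)
Lemma is_basis_leq d d' (b : 'I_d -> V) (b' : 'I_d' -> V) :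
  is_basis U b -> is_basis U b' -> (d' <= d)%N.
Proof.
case=> [_ _ bspan] [b'U b'free _].
have /choice[c hc] : forall i, exists c : 'I_d -> F, b' i = \sum_j c j *: b j.
  by move=> i; apply: bspan.
pose A : 'M[F]_(d', d) := \matrix_(i, j) c i j.
suff /eqP <- : row_free A by apply: rank_leq_col.
apply: inj_row_free => v vA0; apply/rowP => i; rewrite mxE.
apply: (b'free (fun i => v 0 i)).
under eq_bigr => j _ do rewrite hc scaler_sumr.
rewrite exchange_big big1 // => j _ /=.
under eq_bigr => k _ do rewrite scalerA.
rewrite -scaler_suml; have /rowP/(_ j) := vA0; rewrite !mxE => vAj.
rewrite -[RHS](scale0r (b j)) -[in RHS]vAj; congr (_ *: _).
by apply: eq_bigr => k _; rewrite mxE.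
Qed.

Lemma dimension_basis d (b : 'I_d -> V) : is_basis U b -> dimension U = d.
Proof.
move=> hb; rewrite /dimension; set P := fun k => _.
have [b' hb'] : P (epsilon (inhabits 0%N) P) by apply: epsilon_spec; exists d, b.
by apply/eqP; rewrite eqn_leq (is_basis_leq hb hb') (is_basis_leq hb' hb).
Qed.

End Dimension.

(** * Enumeration of normal words by degree and first vertex *)

Section NormalWords.
Variables (G : digraph) (lev : vertex G -> nat).
Local Notation covers := (@covers G lev).

(** Normal words of degree [d] starting at [v], provided [d < f]: each letter has positive degree,
    so the fuel outlasts the word. *)
Fixpoint nwords_upto (f d : nat) (v : vertex G) : seq (word G) :=
  if f is f'.+1 then
    flatten [seq [seq ((v, k) : vertex G * nat) :: x
                | x <- (if (d - k)%N is 0%N then [:: [::]]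
                        else flatten [seq nwords_upto f' (d - k) u
                                     | u <- enum (vertex G)])
                & ~~ covers v k x]
            | k <- iota 1 (minn (lev v) d)]
  else [::].

Definition nwords_from (d : nat) v := nwords_upto d.+1 d v.
Definition nwords (d : nat) : seq (word G) :=
  if d is 0%N then [:: [::]] else flatten [seq nwords_from d v | v <- enum (vertex G)].

Lemma nwords_upto_fuel f f' d v : (d < f)%N -> (d < f')%N ->
  nwords_upto f d v = nwords_upto f' d v.
Proof.
elim: f f' d v => // f IHf [|f'] // d v lt_df lt_df' /=.
congr flatten; apply/eq_in_map => k; rewrite mem_iota => hk; congr map; congr filter.
case e: (d - k)%N => [|j] //; congr flatten; apply: eq_map => u; apply: IHf; lia.
Qed.

Lemma nwords_fromE d v : nwords_from d v =
  flatten [seq [seq ((v, k) : vertex G * nat) :: x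
               | x <- nwords (d - k) & ~~ covers v k x]
          | k <- iota 1 (minn (lev v) d)].
Proof.
rewrite /nwords_from [LHS]/=; congr flatten; apply/eq_in_map => k.
rewrite mem_iota => hk; congr map; congr filter; rewrite /nwords.
case e: (d - k)%N => [|j] //; congr flatten; apply: eq_map => u.
by apply: nwords_upto_fuel; lia.
Qed.

Definition head_is (v : vertex G) (x : word G) :=
  if x is (u, _) :: _ then u == v else false.

Lemma normal_nil_deg d : normal_of_deg lev d [::] = (d == 0%N).
Proof. by rewrite /normal_of_deg /wdeg /= eq_sym. Qed.

Lemma normal_of_deg0 x : normal_of_deg lev 0 x -> x = [::].
Proof.
by case: x => // -[v k] x /andP[/and3P[/andP[k0 _] _ _]]; rewrite /wdeg /=; lia.
Qed.

(** Stated for a single degree, to serve inside the strong induction of [mem_nwords_from]. *)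
Lemma mem_nwords_step d :
  (forall v x, (x \in nwords_from d v) = normal_of_deg lev d x && head_is v x) ->
  forall x, (x \in nwords d) = normal_of_deg lev d x.
Proof.
case: d => [|d] hd x.
  rewrite inE; apply/eqP/idP => [->|/normal_of_deg0 //].
  by rewrite normal_nil_deg.
apply/flatten_mapP/idP => [[u _]|hx]; first by rewrite hd => /andP[].
case: x hx => [|[u m] x] hx; first by rewrite normal_nil_deg in hx.
by exists u; rewrite ?mem_enum // hd hx /=.
Qed.

Lemma mem_nwords_from d v x :
  (x \in nwords_from d v) = normal_of_deg lev d x && head_is v x.
Proof.
elim/ltn_ind: d v x => d IHd v x; have {}IHd k y : (0 < k <= d)%N ->
    (y \in nwords (d - k)) = normal_of_deg lev (d - k) y.
  by move=> hk; apply: mem_nwords_step => u z; apply: IHd; lia.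
rewrite nwords_fromE; apply/flatten_mapP/andP => [[k]|[]].
  rewrite mem_iota => hk /mapP[y]; rewrite mem_filter IHd; last by lia.
  case/and3P=> ncov ny /eqP dy ->; rewrite /normal_of_deg /= ncov ny /wdeg /= eqxx.
  by rewrite -/(wdeg y) dy; lia.
case: x => // -[u k] x /andP[/and3P[hk ncov nx] /eqP dx] /eqP e_uv.
rewrite {u}e_uv in hk ncov dx *; rewrite /wdeg /= -/(wdeg x) in dx.
exists k; first by rewrite mem_iota; lia.
apply/mapP; exists x => //; rewrite mem_filter ncov IHd; last by lia.
by rewrite -dx addKn /normal_of_deg eqxx andbT.
Qed.

Lemma mem_nwords d x : (x \in nwords d) = normal_of_deg lev d x.
Proof. by apply: mem_nwords_step => v y; apply: mem_nwords_from. Qed.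

(** The key recovers the block of an entry, so distinct blocks are disjoint. *)
Lemma uniq_flatten_key (I T : eqType) (key : T -> option I) (f : I -> seq T) s :
  uniq s -> (forall i, i \in s -> uniq (f i)) ->
  (forall i x, i \in s -> x \in f i -> key x = Some i) ->
  uniq (flatten (map f s)).
Proof.
elim: s => //= i s IHs /andP[is_s us] uf hkey; rewrite cat_uniq uf ?mem_head //=.
rewrite IHs // => [|j js|j x js]; last by apply: hkey; rewrite inE js orbT.
  rewrite andbT; apply/hasPn => x /flatten_mapP[j js xj]; apply/negP => xi.
  have := hkey j x; rewrite inE js orbT (hkey i x) ?mem_head // => /(_ isT xj) [e_ij].
  by rewrite e_ij js in is_s.
by apply: uf; rewrite inE js orbT.
Qed.

Lemma uniq_nwords_step d : (forall v, uniq (nwords_from d v)) -> uniq (nwords d).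
Proof.
case: d => // d hd; apply: (@uniq_flatten_key _ _ (fun x => omap fst (ohead x))) => //.
  exact: enum_uniq.
by move=> v [|[u k] x] _; rewrite mem_nwords_from => /andP[_] //= /eqP ->.
Qed.

Lemma uniq_nwords_from d v : uniq (nwords_from d v).
Proof.
elim/ltn_ind: d v => d IHd v; rewrite nwords_fromE.
apply: (@uniq_flatten_key _ _ (fun x => omap snd (ohead x))) => [|k|k x].
- exact: iota_uniq.
- rewrite mem_iota => hk; rewrite map_inj_uniq => [|x y []//]; apply: filter_uniq.
  by apply: uniq_nwords_step => u; apply: IHd; lia.
by move=> _ /mapP[y _ ->].
Qed.

Lemma uniq_nwords d : uniq (nwords d).
Proof. by apply: uniq_nwords_step => v; apply: uniq_nwords_from. Qed.

Lemma size_nwords d : size (nwords d) = ((d == 0) + \sum_v size (nwords_from d v))%N.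
Proof.
case: d => [|d].
  rewrite big1 // => v _; rewrite nwords_fromE minn0; exact: size_flatten.
by rewrite size_flatten /shape -map_comp sumnE big_map big_enum.
Qed.

(** In a normal word the last two conditions of [covers] hold already, so only the first vertex
    matters. *)
Lemma count_covers d v k : count (covers v k) (nwords d) =
  (\sum_(u | gtv v u && (k + lev u == lev v)) size (nwords_from d u))%N.
Proof.
have cov_normal x : normal lev x -> covers v k x =
    if x is (u, _) :: _ then gtv v u && (k + lev u == lev v)%N else false.
  by case: x => //= -[u m] x /and3P[-> -> _]; rewrite !andbT.
case: d => [|d].
  rewrite big1 // => u _; rewrite nwords_fromE minn0; exact: size_flatten.
rewrite count_flatten -map_comp sumnE big_map big_enum [RHS]big_mkcond.
apply: eq_bigr => u _ /=.
have covE x : x \in nwords_from d.+1 u ->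
    covers v k x = gtv v u && (k + lev u == lev v)%N.
  rewrite mem_nwords_from => /andP[/andP[nx _]]; rewrite cov_normal //.
  by case: x {nx} => // -[t m] x /eqP ->.
case: ifP => h; last first.
  by apply/eqP; rewrite -leqn0 leqNgt -has_count; apply/hasPn => x /covE ->; rewrite h.
by apply/eqP; rewrite -all_count; apply/allP => x /covE ->.
Qed.

Lemma size_nwords_from d v : size (nwords_from d v) =
  (\sum_(1 <= k < (minn (lev v) d).+1)
     (size (nwords (d - k)) - count (covers v k) (nwords (d - k))))%N.
Proof.
rewrite nwords_fromE size_flatten /shape -map_comp sumnE big_map.
rewrite /index_iota subSS subn0; apply: eq_bigr => k _ /=.
rewrite size_map size_filter -[in RHS](count_predC (covers v k)) addKn.
exact: eq_count.
Qed.

End NormalWords.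

(** * Arithmetic of power series, by truncation to polynomials *)

Section PowerSeriesTheory.
Variable K : fieldType.
Implicit Types f g h : fps K.

Lemma fps_mul_trunc f g D i : (i <= D)%N ->
  fps_mul f g i = ((\poly_(j < D.+1) f j) * \poly_(j < D.+1) g j)`_i.
Proof.
move=> le_iD; rewrite coefM; apply: eq_bigr => j _; rewrite !coef_poly.
have [-> ->] // : (j < D.+1)%N /\ (i - j < D.+1)%N.
by have := ltn_ord j; lia.
Qed.

Lemma fps_mulA f g h : fps_mul f (fps_mul g h) =1 fps_mul (fps_mul f g) h.
Proof.
move=> D; pose t (k : fps K) : {poly K} := \poly_(j < D.+1) k j.
have tE k j : (j < D.+1)%N -> (t k)`_j = k j by move=> hj; rewrite coef_poly hj.
transitivity ((t f * (t g * t h))`_D); last rewrite mulrA.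
  rewrite coefM; apply: eq_bigr => j _; rewrite tE // (@fps_mul_trunc _ _ D) //.
  exact: leq_subr.
rewrite coefM; apply: eq_bigr => j _; rewrite tE ?ltnS ?leq_subr //.
by rewrite (@fps_mul_trunc _ _ D) // -ltnS.
Qed.

Lemma eq_fps_mul f f' g g' : f =1 f' -> g =1 g' -> fps_mul f g =1 fps_mul f' g'.
Proof. by move=> ff' gg' D; apply: eq_bigr => j _; rewrite ff' gg'. Qed.

Lemma fps_mul1 f : fps_mul f (fps_poly 1) =1 f.
Proof.
move=> D; rewrite /fps_mul big_ord_recr /= subnn /fps_poly coef1 mulr1.
rewrite big1 ?add0r // => j _; rewrite coef1 subn_eq0 leqNgt ltn_ord.
exact: mulr0.
Qed.

Lemma fps_div_eq f g h : g 0%N != 0 -> fps_mul h g =1 f -> fps_div f g =1 h.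
Proof.
move=> g0 hgf D; rewrite /fps_div -(eq_fps_mul hgf (fun=> erefl)) -fps_mulA.
by rewrite (eq_fps_mul (fun=> erefl) (fps_mulV g0)) fps_mul1.
Qed.

End PowerSeriesTheory.

(** * The linear system for the numbers of normal words *)

Section GeneratingFunctions.
Variables (G : digraph) (lev : vertex G -> nat) (n : nat).
Hypothesis hG : layering n lev.
Variable star : vertex G.
Hypothesis lev_star : lev star = 0%N.
Hypothesis gtv_star : forall v, v != star -> gtv v star.

Variable psi : vertex G -> {poly rat}.
Hypothesis psiE : forall v,
  psi v = - 'X - \sum_(u | gtv v u) 'X^(lev v - lev u) * psi u.

Variable D : nat.
Let H : {poly rat} := \poly_(d < D.+1) (size (nwords lev d))%:R.
Let P v : {poly rat} := \poly_(d < D.+1) (size (nwords_from lev d v))%:R.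
(** Congruence to 0 modulo ['X^D.+1], the precision of the truncated series [H] and [P]. *)
Let low (R : {poly rat}) := forall i, (i <= D)%N -> R`_i = 0.

Lemma lowD R S : low R -> low S -> low (R + S).
Proof. by move=> hR hS i le_iD; rewrite coefD hR ?hS ?addr0. Qed.

Lemma lowMl R S : low S -> low (R * S).
Proof.
move=> hS i le_iD; rewrite coefM big1 // => j _.
by rewrite hS ?mulr0 // (leq_trans (leq_subr _ _)).
Qed.

Lemma low_sum (Q : pred (vertex G)) (R : vertex G -> {poly rat}) :
  (forall u, Q u -> low (R u)) -> low (\sum_(u | Q u) R u).
Proof. by move=> hR i le_iD; rewrite coef_sum big1 // => u /hR->. Qed.

Lemma nwords_series : H = 1 + \sum_v P v.
Proof.
apply/polyP => d; rewrite coefD coef1 coef_sum coef_poly.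
under eq_bigr do rewrite coef_poly.
case: ifP => [_|hd]; first by rewrite size_nwords natrD natr_sum.
by rewrite big1 // addr0; case: d hd.
Qed.

(** A first letter [(v, k)] may precede any normal word that it does not cover. A covered word
    starts at some [u] below [v], and then [k = lev v - lev u]. *)
Lemma nwords_from_series v : low (P v - (\sum_(1 <= k < (lev v).+1) 'X^k) * H
  + \sum_(u | gtv v u) 'X^(lev v - lev u) * P u).
Proof.
move=> d le_dD; have lt_dD k : (d - k < D.+1)%N.
  by rewrite ltnS (leq_trans (leq_subr _ _)).
rewrite coefD coefB mulr_suml !coef_sum coef_poly ltnS le_dD size_nwords_from.
rewrite (big_nat_widen _ _ (lev v).+1) ?ltnS ?geq_minl // big_mkcond natr_sum.
under [X in _ - X + _]eq_bigr => k _ do rewrite coefXnM coef_poly lt_dD.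
under [X in _ + X]eq_bigr => u _ do rewrite coefXnM coef_poly lt_dD.
have -> : \sum_(u | gtv v u) (if (d < lev v - lev u)%N then 0
    else (size (nwords_from lev (d - (lev v - lev u)) u))%:R : rat) =
  \sum_(1 <= k < (lev v).+1) (if (d < k)%N then 0
    else (count (covers lev v k) (nwords lev (d - k)))%:R : rat).
  transitivity (\sum_(1 <= k < (lev v).+1) \sum_(u | gtv v u)
      (if k == (lev v - lev u)%N then if (d < k)%N then 0
        else (size (nwords_from lev (d - k) u))%:R else 0 : rat)).
    rewrite exchange_big; apply: eq_bigr => u vu; rewrite -big_mkcond big_nat1_eq.
    by have -> : (1 <= lev v - lev u < (lev v).+1)%N by have := gtv_lev hG vu; lia.
  apply: eq_big_nat => k hk; case: ifP => _.
    by rewrite big1 // => u _; rewrite if_same.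
  rewrite count_covers natr_sum -big_mkcondr; apply: eq_bigl => u.
  by case vu: (gtv v u) => //=; have := gtv_lev hG vu; lia.
rewrite -sumrB -big_split big_nat big1 // => k hk /=.
have -> : (k < (minn (lev v) d).+1)%N = ~~ (d < k)%N by lia.
case: ltnP => _ /=; first by rewrite ?subr0 ?addr0.
by rewrite natrB ?count_size // [LHS]addrAC subrK subrr.
Qed.

Lemma geometric_series m :
  (1 - 'X) * \sum_(1 <= k < m.+1) 'X^k = 'X - 'X^(m.+1) :> {poly rat}.
Proof.
elim: m => [|m IHm]; first by rewrite big_nil mulr0 expr1 subrr.
by rewrite big_nat_recr //= mulrDr IHm !exprS; ring.
Qed.

(** Induction on the level, from [nwords_from_series] times [1 - 'X] and the recurrence of [psi].
    The extra term at [star] absorbs the last power in [geometric_series]. *)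
Lemma psi_series v : low ((1 - 'X) * P v + (psi v + (v == star)%:R * 'X) * H).
Proof.
elim/ltn_ind: {v}(lev v) {-2}v (erefl (lev v)) => l IHl v lv.
move: IHl; rewrite -{}lv => IHl {l}; have [e_v|v_star] := eqVneq v star.
  have no_u u : gtv v u = false.
    by apply/negP => /(gtv_lev hG); rewrite e_v lev_star.
  have -> : P v = 0.
    apply/polyP => d; rewrite coef_poly coef0 nwords_fromE e_v lev_star min0n.
    by rewrite if_same.
  rewrite psiE big_pred0 // => d _.
  by rewrite mulr0 subr0 mul1r addNr mul0r addr0 coef0.
set A := \sum_(1 <= k < (lev v).+1) 'X^k : {poly rat}.
set S := \sum_(u | gtv v u) 'X^(lev v - lev u) * P u.
have E : (1 - 'X) * P v + (psi v + false%:R * 'X) * H =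
    (1 - 'X) * (P v - A * H + S) + (- 1) * \sum_(u | gtv v u)
      'X^(lev v - lev u) * ((1 - 'X) * P u + (psi u + (u == star)%:R * 'X) * H).
  have -> : \sum_(u | gtv v u) 'X^(lev v - lev u) *
       ((1 - 'X) * P u + (psi u + (u == star)%:R * 'X) * H) =
      (1 - 'X) * S + (\sum_(u | gtv v u) 'X^(lev v - lev u) * psi u) * H
        + 'X^((lev v).+1) * H.
    have -> : 'X^((lev v).+1) =
        \sum_(u | gtv v u) 'X^(lev v - lev u) * ((u == star)%:R * 'X) :> {poly rat}.
      rewrite (bigD1 star) ?gtv_star //= eqxx mul1r lev_star subn0 -exprSr.
      by rewrite big1 ?addr0 // => u /andP[_ /negbTE->]; rewrite mul0r mulr0.
    rewrite /S mulr_sumr !mulr_suml -!big_split; apply: eq_bigr => u _ /=.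
    by ring.
  have := geometric_series (lev v); rewrite -/A psiE => /(congr1 (fun R => R * H)).
  set B := \sum_(u | _) _; set Y := 'X^_; rewrite -mulrA => h.
  by rewrite [X in _ = X + _]mulrDr mulrBr h mul0r; ring.
rewrite E; apply: lowD; apply: lowMl; first exact: nwords_from_series.
apply: low_sum => u vu; apply: lowMl; apply: IHl (erefl _).
exact: gtv_lev hG vu.
Qed.

(** Sum [psi_series] over all vertices and use that the [P v] add up to [H - 1]. *)
Lemma nwords_psi : ((1 + \sum_v psi v) * H)`_D = (1 - 'X)`_D.
Proof.
apply/eqP; rewrite -subr_eq0 -coefB; apply/eqP.
suff -> : (1 + \sum_v psi v) * H - (1 - 'X) =
    \sum_v ((1 - 'X) * P v + (psi v + (v == star)%:R * 'X) * H).
  by apply: low_sum => // v _; apply: psi_series.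
rewrite big_split -mulr_sumr -mulr_suml big_split /=.
have -> : \sum_v (v == star)%:R * 'X = 'X :> {poly rat}.
  rewrite (bigD1 star) //= eqxx mul1r big1 ?addr0 // => u /negbTE ->.
  exact: mul0r.
have -> : \sum_v P v = H - 1 by rewrite nwords_series addrC addKr.
ring.
Qed.

End GeneratingFunctions.

(** * Chains *)

Lemma big_cons_tuple (R : nmodType) (T : finType) l (Q : pred (seq T)) (f : seq T -> R) :
  \sum_(c : l.+1.-tuple T | Q c) f c =
  \sum_(v : T) \sum_(c : l.-tuple T | Q (v :: c)) f (v :: c).
Proof.
rewrite pair_big_dep /= (reindex (fun p : T * l.-tuple T => [tuple of p.1 :: p.2])) //=.
exists (fun c => (thead c, [tuple of behead c])) => [[v c] _|c _] /=.
  by congr (_, _); apply: val_inj.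
by rewrite [RHS]tuple_eta.
Qed.

Section Chains.
Variables (G : digraph) (n : nat) (lev : vertex G -> nat) (star : vertex G).
Hypothesis hG : layering n lev.
Hypothesis gev_star : forall v, gev v star.

(** The contribution of the chains with [l.+1] vertices that start at [v]. *)
Fixpoint chain_series (l : nat) (v : vertex G) : {poly rat} :=
  if l is l'.+1 then - \sum_(u | gtv v u) 'X^(lev v - lev u) * chain_series l' u
  else - 'X.

Lemma lev_last v c : sorted (@gtv G) (v :: c) -> (lev (last v c) <= lev v)%N.
Proof.
elim: c v => //= u c IHc v /andP[vu hc].
by apply: leq_trans (IHc u hc) _; apply: ltnW; apply: gtv_lev hG vu.
Qed.

Lemma chain_seriesE l v :
  \sum_(c : l.-tuple (vertex G) | is_chain star (v :: c))
    (-1) ^+ l.+1 *: 'X^(chain_exp lev star (v :: c)) = chain_series l v.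
Proof.
elim: l v => [|l IHl] v.
  rewrite (big_pred1 [tuple]) => [|c]; last first.
    by rewrite tuple0 /is_chain /= gev_star eqxx.
  by rewrite /chain_exp /= subnn expr1 scaleN1r.
rewrite (big_cons_tuple _ (fun c => is_chain star (v :: c))
  (fun c => (-1) ^+ l.+2 *: 'X^(chain_exp lev star (v :: c)))) /=.
rewrite -sumrN [RHS]big_mkcond; apply: eq_bigr => u _.
rewrite /is_chain /=; case vu: (gtv v u) => /=; last by rewrite big_pred0.
rewrite -IHl mulr_sumr -sumrN; apply: eq_bigr => c /andP[hc _].
rewrite -scalerAr -exprD exprS mulN1r scaleNr; congr (- (_ *: 'X^_)).
(* Levels decrease along the chain, so the truncated differences add up. *)
have := lev_last (v := u) hc; have := gtv_lev hG vu; rewrite /chain_exp /=; lia.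
Qed.

Definition psi v : {poly rat} := \sum_(l < #|vertex G|) chain_series l v.

Lemma psi_rec v : psi v = - 'X - \sum_(u | gtv v u) 'X^(lev v - lev u) * psi u.
Proof.
(* Chains do not repeat vertices, so this term is empty; adding it allows the shift of the index
   [l]. *)
have last0 : chain_series #|vertex G| v = 0.
  rewrite -chain_seriesE big_pred0 // => c; apply/negP => /(size_chain hG) /=.
  by rewrite size_tuple ltnn.
rewrite -[LHS]addr0 -[in LHS]last0 /psi.
have -> : \sum_(l < #|vertex G|) chain_series l v + chain_series #|vertex G| v =
    \sum_(l < #|vertex G|.+1) chain_series l v by rewrite big_ord_recr.
rewrite big_ord_recl /=; congr (_ + _); rewrite sumrN; congr (- _).
rewrite exchange_big; apply: eq_bigr => u _ /=; by rewrite mulr_sumr.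
Qed.

Lemma sum_psi : \sum_v psi v =
  \sum_(1 <= l < #|vertex G|.+1)
    \sum_(c : l.-tuple (vertex G) | is_chain star c)
      (-1) ^+ l *: 'X^(chain_exp lev star c).
Proof.
rewrite exchange_big big_add1 big_mkord; apply: eq_bigr => l _.
rewrite (big_cons_tuple _ (is_chain star)
  (fun c => (-1) ^+ l.+1 *: 'X^(chain_exp lev star c))).
by apply: eq_bigr => v _; rewrite chain_seriesE.
Qed.

End Chains.

Theorem theorem2 (F : fieldType) (G : digraph) (n : nat)
    (lev : vertex G -> nat) (star : vertex G)
    (hG : layering n lev)
    (hstar : forall v : vertex G, lev v = 0%N <-> v = star)
    (htail : forall v : vertex G, (0 < lev v)%N ->
       exists e : edge G, tail_of e = v) :
  fps_div (fps_poly (1 - 'X)) (hilbert_series F G) =1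
  fps_poly (1 + \sum_(1 <= l < #|vertex G|.+1)
                  \sum_(c : l.-tuple (vertex G) | is_chain star c)
                    (-1) ^+ l *: 'X^(chain_exp lev star c)).
Proof.
have lev_star : lev star = 0%N by apply/hstar.
have gtv_star v : v != star -> gtv v star.
  (* Edges lower the level, so following them from [v] ends at [star]. *)
  elim/ltn_ind: {v}(lev v) {-2}v (erefl (lev v)) => l IHl v lv v_star.
  have [e e_v] : exists e : edge G, tail_of e = v.
    by apply: htail; rewrite lt0n; apply: contra v_star => /eqP/hstar->.
  have [h_star|h_star] := eqVneq (head_of e) star.
    by rewrite -e_v -h_star gtv_edge.
  rewrite -e_v; apply: gtv_trans (gtv_edge e) _; apply: IHl (erefl _) h_star.
  by rewrite -lv -e_v; apply: gtv_lev hG (gtv_edge e).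
have gev_star v : gev v star.
  by rewrite /gev; case: eqVneq => [_|/gtv_star->]; rewrite ?orbT.
have [sp hsp] : exists sp : vertex G -> seq (edge G),
    forall v, v = star /\ sp v = [::] \/ is_path v star (sp v).
  apply: (choice (fun v p => v = star /\ p = [::] \/ is_path v star p)) => v.
  have [->|/gtv_star/asboolP[p hp]] := eqVneq v star; first by exists [::]; left.
  by exists p; right.
have hilbertE d : hilbert_series F G d = (size (nwords lev d))%:R.
  have := graded_piece_basis F hG lev_star hsp (uniq_nwords lev d) (mem_nwords lev d).
  by move/dimension_basis => dimE; rewrite /hilbert_series dimE.
apply: fps_div_eq => [|d]; first by rewrite hilbertE oner_eq0.
rewrite -(sum_psi hG gev_star) /fps_poly.
(* Truncation at degree [d] is exact for the coefficient of degree [d]. *)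
rewrite -(nwords_psi hG lev_star gtv_star (psi_rec hG gev_star) d) coefM.
apply: eq_bigr => i _; rewrite hilbertE coef_poly.
by rewrite ltnS leq_subr.
Qed.
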